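(* Let $k\in\mathbb{N}$ be a fixed constant. The Almost Disjoint Paths problem (ADP) with this fixed $k$ can be solved in polynomial time on directed acyclic graphs: there is a polynomial-time algorithm that, given a directed acyclic graph $G=(V,A)$ and vertices $s,t\in V$, decides whether $G$ contains $k$ almost disjoint $s$-$t$-paths.
   Context: Directed graphs may contain parallel arcs; paths are directed paths without repeated vertices. A set of paths is called almost disjoint if every two paths of the set have at most one arc in common. The Almost Disjoint Paths problem (ADP): given a directed graph $G=(V,A)$, vertices $s,t\in V$, and $k\in\mathbb{N}$, decide whether there exist $k$ $s$-$t$-paths in $G$ that are pairwise almost disjoint. *)

(* Defs.v *)
From mathcomp Require Import all_boot.
Set Implicit Arguments. Unset Strict Implicit. Unset Printing Implicit Defensive.

(* A graph instance: vertices are 0..nV-1; arcs are listed with their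
   identity being their index in the list (so parallel arcs are distinct). *)
Record instance := Instance {
  nV : nat;
  arcs : seq (nat * nat);
  src : nat;
  tgt : nat }.

Definition well_formed (I : instance) : bool :=
  [&& src I < nV I, tgt I < nV I &
      all (fun e : nat * nat => (e.1 < nV I) && (e.2 < nV I)) (arcs I)].

Definition arc_tail (I : instance) (a : nat) : nat := (nth (0, 0) (arcs I) a).1.
Definition arc_head (I : instance) (a : nat) : nat := (nth (0, 0) (arcs I) a).2.

Fixpoint walk (I : instance) (u v : nat) (p : seq nat) : bool :=
  match p with
  | [::] => u == v
  | a :: p' => [&& a < size (arcs I), arc_tail I a == u & walk I (arc_head I a) v p']
  end.

Definition walk_vertices (I : instance) (u : nat) (p : seq nat) : seq nat :=
  u :: map (arc_head I) p.

Definition is_path (I : instance) (u v : nat) (p : seq nat) : bool :=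
  walk I u v p && uniq (walk_vertices I u p).

Definition acyclic (I : instance) : Prop :=
  forall (v : nat) (p : seq nat), walk I v v p -> p = [::].

Definition almost_disjoint (p q : seq nat) : Prop :=
  forall a b : nat, a \in p -> a \in q -> b \in p -> b \in q -> a = b.

Definition ADP (k : nat) (I : instance) : Prop :=
  exists P : 'I_k -> seq nat,
    [/\ forall i, is_path I (src I) (tgt I) (P i),
        injective P &
        forall i j, i != j -> almost_disjoint (P i) (P j)].

Definition enc_nat (n : nat) : seq bool := nseq n true ++ [:: false].

Fixpoint enc_arcs (l : seq (nat * nat)) : seq bool :=
  match l with
  | [::] => [:: false]
  | e :: l' => true :: enc_nat e.1 ++ enc_nat e.2 ++ enc_arcs l'
  end.

Definition encode (I : instance) : seq bool :=
  enc_nat (nV I) ++ enc_nat (src I) ++ enc_nat (tgt I) ++ enc_arcs (arcs I).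

Inductive move := MoveL | MoveR | Stay.

(* tape symbols: Some b = bit b, None = blank *)
Definition symbol := option bool.

Record TM (Q : finType) := MkTM {
  tm_start : Q;
  (* None = halt *)
  tm_delta : Q -> symbol -> option (Q * symbol * move);
  tm_accept : Q -> bool }.

(* configuration: state, left part (reversed, nearest first), head symbol, right part *)
Definition config (Q : finType) := (Q * seq symbol * symbol * seq symbol)%type.

Definition init_config (Q : finType) (M : TM Q) (w : seq bool) : config Q :=
  match w with
  | [::] => (tm_start M, [::], None, [::])
  | b :: w' => (tm_start M, [::], Some b, map Some w')
  end.

Definition halted (Q : finType) (M : TM Q) (c : config Q) : bool :=
  let: (q, _, h, _) := c in
  if tm_delta M q h is None then true else false.

Definition step (Q : finType) (M : TM Q) (c : config Q) : option (config Q) :=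
  let: (q, l, h, r) := c in
  match tm_delta M q h with
  | None => None
  | Some (q', x, m) =>
      Some match m with
           | Stay => (q', l, x, r)
           | MoveL => match l with
                      | [::] => (q', [::], None, x :: r)
                      | y :: l' => (q', l', y, x :: r)
                      end
           | MoveR => match r with
                      | [::] => (q', x :: l, None, [::])
                      | y :: r' => (q', x :: l, y, r')
                      end
           end
  end.

Fixpoint exec (Q : finType) (M : TM Q) (n : nat) (c : config Q) : config Q :=
  match n with
  | 0 => c
  | n'.+1 => match step M c with
             | None => c
             | Some c' => exec M n' c'
             end
  end.

Definition halts_with (Q : finType) (M : TM Q) (w : seq bool) (T : nat) (b : bool) : Prop :=
  let c := exec M T (init_config M w) in
  halted M c /\ tm_accept M c.1.1.1 = b.

(* Main.v *)
Require Import Defs.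
From Stdlib Require Import FunctionalExtensionality Classical.
From mathcomp Require Import all_boot zify.
Set Implicit Arguments. Unset Strict Implicit. Unset Printing Implicit Defensive.

(* Guess, for all paths i < j, the only arc e_ij that they may share, and play a
   pebble game: pebble i starts at s, and the pebbles at a vertex u that no
   other pebble can reach move at once along arcs leaving u.  By acyclicity two
   paths can only share an arc if their pebbles cross it in the same round, so
   it is enough to check each round locally.  Two almost disjoint s-t-paths with
   s <> t are equal only if both consist of one arc from s to t, so forbidding
   such an arc to be shared makes the paths distinct.

   Positions of the game are tuples of vertices and arcs, so the winning ones
   form a relation of fixed arity on {0, ..., N - 1}, N the input length, which
   is a least fixed point of a first-order formula over the input word.  As in
   the Immerman-Vardi theorem, such iterated definitions are evaluated in
   polynomial time: a formula becomes nested loops over unary counters and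
   tables kept on finitely many stacks, and a single-tape machine keeps the
   stacks side by side, separated by blanks, so that a push or a pop shifts
   the rest of the tape by one cell. *)

(** * Stack programs *)

(** A position need not record how the pebbles came to it: once all pebbles have left [u], no
    remaining piece of a path uses an arc leaving [u]. Pebbles at [t] are exempt from the
    reachability test, since they stay there even if [t] reaches [u]. Every round shortens the
    remaining paths, whose total length is at most [k * nV I], so a bound of [N ^ k.+1] rounds
    suffices. This many stages come from [k.+1] nested counting loops, and no test for convergence
    has to be programmed.

    Besides the winning positions, two more relations are defined by stages: reachability, and the
    positions of the word at which entries of the arc list begin. The latter cannot be recognized
    locally, because a bit inside a unary number looks just like the mark in front of an arc. As
    numbers are written in unary, all vertices are below [N]. An arc is named by the position of its
    mark, which is below [N] as well and tells parallel arcs apart. *)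

Definition polyb (f : nat -> nat) := exists c d, forall n, f n <= c * n.+1 ^ d.

Lemma polyb_const c : polyb (fun=> c).
Proof. by exists c, 0 => n; rewrite muln1. Qed.

Lemma polyb_id : polyb id.
Proof. by exists 1, 1 => n; rewrite mul1n expn1. Qed.

Lemma polyb_add f g : polyb f -> polyb g -> polyb (fun n => f n + g n).
Proof.
move=> [c [d Hf]] [c' [d' Hg]]; exists (c + c'), (d + d') => n.
rewrite mulnDl leq_add //.
  by apply: leq_trans (Hf n) _; rewrite leq_mul // leq_pexp2l // leq_addr.
by apply: leq_trans (Hg n) _; rewrite leq_mul // leq_pexp2l // leq_addl.
Qed.

Lemma polyb_mul f g : polyb f -> polyb g -> polyb (fun n => f n * g n).
Proof.
move=> [c [d Hf]] [c' [d' Hg]]; exists (c * c'), (d + d') => n.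
by rewrite expnD mulnACA leq_mul.
Qed.

Lemma polyb_exp f d : polyb f -> polyb (fun n => f n ^ d).
Proof.
move=> Hf; elim: d => [|d IH]; first exact: polyb_const.
case: (polyb_mul Hf IH) => c [e H]; exists c, e => n.
by rewrite expnS.
Qed.

Definition upd (A : eqType) (B : Type) (f : A -> B) (a : A) (b : B) : A -> B :=
  fun x => if x == a then b else f x.

Section While.
Variable reg : eqType.

Definition store := reg -> seq bool.

Inductive cmd :=
  | Skip
  | Push of reg & bool
  | Pop of reg
  | Seq of cmd & cmd
  | If of reg & (option bool -> bool) & cmd & cmd
  | While of reg & (option bool -> bool) & cmd.

(** The costs are those of the compiled code: a test pays for the conditional jump and for the jump
    over the other branch, a round of a loop for the test and the jump back. [runs_le] turns them
    into upper bounds, so that branches of different cost can be joined. *)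
Inductive runs : cmd -> store -> store -> nat -> Prop :=
  | runs_skip s : runs Skip s s 0
  | runs_push r b s : runs (Push r b) s (upd s r (b :: s r)) 1
  | runs_pop r s : runs (Pop r) s (upd s r (behead (s r))) 1
  | runs_seq c1 c2 s1 s2 s3 t1 t2 : runs c1 s1 s2 t1 -> runs c2 s2 s3 t2 ->
      runs (Seq c1 c2) s1 s3 (t1 + t2)
  | runs_if r (f : option bool -> bool) c1 c2 s s' t :
      runs (if f (ohead (s r)) then c1 else c2) s s' t ->
      runs (If r f c1 c2) s s' (t + 2)
  | runs_while_stop r (f : option bool -> bool) c s : ~~ f (ohead (s r)) -> runs (While r f c) s s 1
  | runs_while_go r (f : option bool -> bool) c s1 s2 s3 t1 t2 : f (ohead (s1 r)) ->
      runs c s1 s2 t1 -> runs (While r f c) s2 s3 t2 ->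
      runs (While r f c) s1 s3 (t1 + t2 + 2)
  | runs_le c s s' t t' : runs c s s' t -> t <= t' -> runs c s s' t'.

Inductive instr :=
  | IPush of reg & bool
  | IPop of reg
  | IJump of reg & (option bool -> bool) & nat.

Definition instr_reg i := match i with IPush r _ => r | IPop r => r | IJump r _ _ => r end.

Definition target_le n i := if i is IJump _ _ p then p <= n else true.

(** Jump targets are absolute addresses, so each fragment is compiled for the address [b] at which
    it will stand. *)
Fixpoint compile (b : nat) (c : cmd) : seq instr :=
  match c with
  | Skip => [::]
  | Push r x => [:: IPush r x]
  | Pop r => [:: IPop r]
  | Seq c1 c2 => let p1 := compile b c1 in p1 ++ compile (b + size p1) c2
  | If r f c1 c2 =>
      let p2 := compile b.+1 c2 in
      let b1 := (b + size p2).+2 in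
      let p1 := compile b1 c1 in
      IJump r f b1 :: p2 ++ IJump r xpredT (b1 + size p1) :: p1
  | While r f c1 =>
      let p1 := compile b.+1 c1 in
      IJump r (predC f) (b + size p1).+2 :: p1 ++ [:: IJump r xpredT b]
  end.

Lemma target_compile b c n : b + size (compile b c) <= n ->
  all (target_le n) (compile b c).
Proof.
elim: c b n => //= [c1 IH1 c2 IH2|r f c1 IH1 c2 IH2|r f c1 IH1] b n.
- by rewrite size_cat => H; rewrite all_cat IH1 ?IH2 //; lia.
- rewrite size_cat /= => H; rewrite all_cat /= IH1 ?IH2 //; lia.
- by rewrite size_cat /= => H; rewrite all_cat /= IH1 //; lia.
Qed.

Definition exec_instr (i : instr) (x : nat * store) : nat * store :=
  let: (pc, s) := x in
  match i with
  | IPush r b => (pc.+1, upd s r (b :: s r))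
  | IPop r => (pc.+1, upd s r (behead (s r)))
  | IJump r f p => (if f (ohead (s r)) then p else pc.+1, s)
  end.

Definition step_code (code : seq instr) (x : nat * store) : nat * store :=
  if onth code x.1 is Some i then exec_instr i x else x.

Definition code_at (code : seq instr) b (p : seq instr) :=
  forall i, i < size p -> onth code (b + i) = onth p i.

Lemma code_at_cons code b i p :
  code_at code b (i :: p) -> onth code b = Some i /\ code_at code b.+1 p.
Proof.
move=> H; split; first by have := H 0 isT; rewrite addn0.
by move=> j jp; have := H j.+1 jp; rewrite addnS.
Qed.

Lemma code_at_cat code b p1 p2 :
  code_at code b (p1 ++ p2) -> code_at code b p1 /\ code_at code (b + size p1) p2.
Proof.
move=> H; split=> i ip.
  by rewrite H ?size_cat ?(ltn_addr _ ip) // onth_cat ip.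
by rewrite -addnA H ?size_cat ?ltn_add2l // onth_cat ltnNge leq_addr addKn.
Qed.

(** By induction on the run, not on the command: the remaining rounds of a loop are a run of the
    same command at the same address. As [code_at] constrains only the fragment itself, the result
    applies inside any larger program. *)
Lemma compile_correct c s s' t : runs c s s' t ->
  forall code b, code_at code b (compile b c) -> exists2 n, n <= t &
    iter n (step_code code) (b, s) = (b + size (compile b c), s').
Proof.
have step1 code b i x : onth code b = Some i -> step_code code (b, x) = exec_instr i (b, x).
  by rewrite /step_code => ->.
elim=> {c s s' t}.
- by move=> s code b _; exists 0; rewrite //= addn0.
- by move=> r x s code b /code_at_cons[/step1 E _]; exists 1; rewrite //= E addn1.
- by move=> r s code b /code_at_cons[/step1 E _]; exists 1; rewrite //= E addn1.
- move=> c1 c2 s1 s2 s3 t1 t2 _ IH1 _ IH2 code b /= /code_at_cat[H1 H2].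
  have [n1 le1 E1] := IH1 _ _ H1; have [n2 le2 E2] := IH2 _ _ H2.
  exists (n2 + n1); first by rewrite addnC leq_add.
  by rewrite iterD E1 E2 size_cat addnA.
- move=> r f c1 c2 s s' t _ IH code b /= /code_at_cons[/step1 E0].
  move=> /code_at_cat[H2 /code_at_cons[/step1 E1 H1]].
  case: ifP IH => fr IH.
  + have [|n le E] := IH code (b + size (compile b.+1 c2)).+2.
      by move: H1; rewrite !addSn.
    exists n.+1; first by lia.
    by rewrite iterSr E0 /= fr E size_cat /=; congr pair; lia.
  + have [n le E] := IH _ _ H2.
    exists n.+2; first by lia.
    rewrite iterSr E0 /= fr -iterS iterS E E1 /=.
    by rewrite size_cat /=; congr pair; lia.
- move=> r f c s nf code b /= /code_at_cons[/step1 E0 _]; exists 1 => //.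
  by rewrite /= E0 /= nf size_cat /=; congr pair; lia.
- move=> r f c s1 s2 s3 t1 t2 fr _ IH1 _ IH2 code b /= Hc.
  have /code_at_cons[/step1 E0 /code_at_cat[H1 /code_at_cons[/step1 E1 _]]] := Hc.
  have [n1 le1 E2] := IH1 _ _ H1; have [n2 le2 E3] := IH2 _ _ Hc.
  exists (n2 + (n1.+1).+1); first by lia.
  by rewrite iterD [iter n1.+2 _ _]iterS iterSr E0 /= fr /= E2 E1.
- move=> c s s' t t' _ IH le code b H.
  by have [n len E] := IH _ _ H; exists n => //; apply: leq_trans le.
Qed.
End While.

(** * A Turing machine for stack programs *)

Section Tape.
Variables (Q : finType) (M : TM Q).
Implicit Types (q : Q) (l r s : seq symbol).

(** Two views of a configuration: the scanned cell is counted to the right part or to the left part,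
    and an empty part supplies a blank. Sweeps in one direction then become inductions on the swept
    word without boundary cases. *)
Definition cfg q l s : config Q := (q, l, head None s, behead s).
Definition cfgL q l r : config Q := (q, behead l, head None l, r).

Lemma step_cfg q l s : step M (cfg q l s) =
  if tm_delta M q (head None s) is Some (q', x, d) then
    Some match d with
         | MoveL => cfgL q' l (x :: behead s)
         | MoveR => cfg q' (x :: l) (behead s)
         | Stay => cfg q' l (x :: behead s)
         end
  else None.
Proof.
rewrite /step /cfg /cfgL; case: tm_delta => // [[[q' x] []]] //.
- by case: l.
- by case: (behead s).
Qed.

Lemma step_cfgL q l r : step M (cfgL q l r) =
  if tm_delta M q (head None l) is Some (q', x, d) then
    Some match d with
         | MoveL => cfgL q' (behead l) (x :: r)
         | MoveR => cfg q' (x :: behead l) r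
         | Stay => cfgL q' (x :: behead l) r
         end
  else None.
Proof.
rewrite /step /cfg /cfgL; case: tm_delta => // [[[q' x] []]] //.
- by case: (behead l).
- by case: r.
Qed.

Lemma exec_step n c c' : step M c = Some c' -> exec M n.+1 c = exec M n c'.
Proof. by move=> /= ->. Qed.

Lemma execD n1 n2 c : exec M (n1 + n2) c = exec M n2 (exec M n1 c).
Proof.
elim: n1 c => //= n1 IH c; case E: (step M c) => [c'|]; first exact: IH.
by case: n2 {IH} => //= n2; rewrite E.
Qed.

Lemma halted_step c : halted M c -> step M c = None.
Proof. by case: c => [[[q l] h] r] /=; case: tm_delta. Qed.

Lemma exec_halted n T c : halted M (exec M n c) -> n <= T -> exec M T c = exec M n c.
Proof.
move=> H /subnKC <-; rewrite execD; move: (T - n) => [|d] //=.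
by rewrite halted_step.
Qed.

(* Needed since the initial tape lacks the blanks that separate the empty stacks. *)
Definition sim_config (c c' : config Q) :=
  c.1 = c'.1 /\ nth None c.2 =1 nth None c'.2.

Lemma sim_step c c' : sim_config c c' ->
  match step M c, step M c' with
  | Some d, Some d' => sim_config d d'
  | None, None => True
  | _, _ => False
  end.
Proof.
case: c c' => [[[q l] h] r] [[[q' l'] h'] r'] [/= [<- <- <-]] E.
have Eb (s : seq symbol) i : nth None (behead s) i = nth None s i.+1 by case: s => //=; rewrite nth_nil.
case: tm_delta => [[[p x] []]|] //.
- by case: l => [|y l]; split=> // -[|i] /=.
- have := E 0; have: forall i, nth None (behead r) i = nth None (behead r') i.
    by move=> i; rewrite !Eb.
  by case: r r' E => [|a r] [|a' r'] E /= E1 E0; split=> //=; rewrite -?E0 ?E0.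
Qed.

Lemma sim_exec n c c' : sim_config c c' -> sim_config (exec M n c) (exec M n c').
Proof.
elim: n c c' => //= n IH c c' S; move: (sim_step S).
by case: step => [d|]; case: step => [d'|] // /IH.
Qed.
End Tape.

(** * Stacks as blocks of the tape closed by blanks *)

Definition blanks (Y : seq symbol) := count_mem None Y.

Lemma blanks_cons h Y : blanks (h :: Y) = (h == None) + blanks Y.
Proof. by []. Qed.

Lemma blanks_cat Y1 Y2 : blanks (Y1 ++ Y2) = blanks Y1 + blanks Y2.
Proof. exact: count_cat. Qed.

Lemma blanks_rev Y : blanks (rev Y) = blanks Y.
Proof. exact: count_rev. Qed.

Definition flat (ss : seq (seq bool)) : seq symbol :=
  flatten [seq rcons (map Some s) None | s <- ss].

Lemma flat_cat ss1 ss2 : flat (ss1 ++ ss2) = flat ss1 ++ flat ss2.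
Proof. by rewrite /flat map_cat flatten_cat. Qed.

Lemma flat_cons s ss : flat (s :: ss) = map Some s ++ None :: flat ss.
Proof. by rewrite /flat /= cat_rcons. Qed.

(** Stacks contain only bits, so the blanks are exactly the ends of stacks, and a stack can be
    located by counting blanks. *)
Lemma count_flat ss : blanks (flat ss) = size ss.
Proof.
elim: ss => //= s ss IH; rewrite flat_cons blanks_cat blanks_cons IH.
rewrite (_ : blanks _ = 0) // /blanks count_map; apply/eqP.
by rewrite -leqn0 leqNgt -has_count; apply/hasPn.
Qed.

Lemma size_flat ss : size (flat ss) = sumn (map size ss) + size ss.
Proof. by elim: ss => //= s ss IH; rewrite flat_cons size_cat /= IH size_map; lia. Qed.

Lemma flat_rcons ss : 0 < size ss -> exists Y : seq symbol, flat ss = rcons Y None.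
Proof.
case/lastP: ss => // ss s _; exists (flat ss ++ map Some s).
by rewrite -cats1 flat_cat flat_cons /= rcons_cat cats1.
Qed.

Lemma count_rcons (Y : seq symbol) (ss : seq (seq bool)) : flat ss = rcons Y None -> (blanks Y).+1 = size ss.
Proof. by move=> E; rewrite -count_flat E -cats1 blanks_cat addn1. Qed.

Section Machine.
Variables (reg : eqType) (code : seq (instr reg)) (rs : seq reg).
Let L := size code.
Let m := size rs.

(** Program counters go up to [L.+1]: both [L] and [L.+1] lie beyond the code and halt, the first
    rejecting and the second accepting. *)
Definition state := ('I_L.+2 * 'I_7 * 'I_m.+1 * 'I_m.+1 * symbol)%type.

Definition mkstate (pc tag i j : nat) (x : symbol) : state :=
  (inord pc, inord tag, inord i, inord j, x).

(** Between instructions the head stands on the first cell of the first stack. The state already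
    holds the number of separators to be passed before the stack of the next instruction; for the
    first stack the search is left out. *)
Definition home pc : state :=
  let j := if onth code pc is Some i then index (instr_reg i) rs else 0 in
  mkstate pc (if j == 0 then 0 else 1) j 0 None.

Definition last_blank n (h : symbol) := (h == None) && (n == 1).

(* Each instruction on stack [j] is executed by two sweeps of the tape; [i]
   counts the blanks still to be met.  Tag 1 seeks the top of stack [j] and
   tag 0 acts on it; tag 2 moves right, inserting the carried symbol [x];
   tags 3 and 4 move right to the last blank, tag 4 heralding a deletion;
   tag 5 moves left, shifting cells down to the top of stack [j]; tag 6 moves
   left back home. *)
Definition transition pc tag i j x (h : symbol) : option (state * symbol * move) :=
  match tag with
  | 0 =>
      match onth code pc with
      | None => None
      | Some (IPush r b) => Some (mkstate pc.+1 2 (m - index r rs) 0 (Some b), h, Stay)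
      | Some (IPop r) =>
          Some (mkstate pc.+1 (if h is None then 3 else 4) (m - index r rs) (index r rs) None, h, Stay)
      | Some (IJump r f p) =>
          Some (mkstate (if f h then p else pc.+1) 3 (m - index r rs) 0 None, h, Stay)
      end
  | 1 => if last_blank i h then Some (mkstate pc 0 0 0 None, h, MoveR)
         else Some (mkstate pc 1 (i - (h == None)) j None, h, MoveR)
  | 2 => if last_blank i h then Some (mkstate pc 3 1 0 None, x, MoveR)
         else Some (mkstate pc 2 (i - (h == None)) j h, x, MoveR)
  | 3 => if last_blank i h then Some (mkstate pc 6 m 0 None, h, MoveL)
         else Some (mkstate pc 3 (i - (h == None)) j None, h, MoveR)
  | 4 => if last_blank i h then Some (mkstate pc 5 (m - j) j None, h, MoveL)
         else Some (mkstate pc 4 (i - (h == None)) j None, h, MoveR)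
  | 5 => if last_blank i h then
           if j == 0 then Some (home pc, h, MoveR)
           else Some (mkstate pc 6 j 0 None, h, MoveL)
         else Some (mkstate pc 5 (i - (h == None)) j h, x, MoveL)
  | _ => if last_blank i h then Some (home pc, h, MoveR)
         else Some (mkstate pc 6 (i - (h == None)) j None, h, MoveL)
  end.

Definition machine : TM state := {|
  tm_start := home 0;
  tm_delta := fun q h => let: (pc, tag, i, j, x) := q in transition pc tag i j x h;
  tm_accept := fun q => q.1.1.1.1 == L.+1 :> nat |}.

Lemma deltaE pc tag i j x h : pc < L.+2 -> tag < 7 -> i <= m -> j <= m ->
  tm_delta machine (mkstate pc tag i j x) h = transition pc tag i j x h.
Proof. by move=> ? ? ? ?; rewrite /= !inordK. Qed.

Lemma not_last n h (Y : seq symbol) :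
  blanks (h :: Y) < n -> last_blank n h = false.
Proof. by rewrite blanks_cons /last_blank; case: h => //=; lia. Qed.

Lemma sweep_right pc tag j (Y : seq symbol) n l r :
  pc < L.+2 -> tag \in [:: 1; 3; 4] -> j <= m -> blanks Y < n -> n <= m ->
  exec machine (size Y) (cfg (mkstate pc tag n j None) l (Y ++ r))
  = cfg (mkstate pc tag (n - blanks Y) j None) (rev Y ++ l) r.
Proof.
move=> Hpc Ht Hj; elim: Y n l => [|h Y IH] n l Hn nm; first by rewrite /blanks /= subn0.
have lt7 : tag < 7 by move: Ht; rewrite !inE; lia.
rewrite [size _]/= (@exec_step _ _ _ _ (cfg (mkstate pc tag (n - (h == None)) j None) (h :: l) (Y ++ r))).
  by rewrite IH ?rev_cons ?cat_rcons ?subnDA //; move: Hn; rewrite blanks_cons; lia.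
rewrite step_cfg deltaE //=.
by move: Ht; rewrite !inE => /or3P[] /eqP-> /=; rewrite (not_last Hn).
Qed.

Lemma sweep_left pc j Y n l r :
  pc < L.+2 -> j <= m -> blanks Y < n -> n <= m ->
  exec machine (size Y) (cfgL (mkstate pc 6 n j None) (Y ++ l) r)
  = cfgL (mkstate pc 6 (n - blanks Y) j None) l (rev Y ++ r).
Proof.
move=> Hpc Hj; elim: Y n r => [|h Y IH] n r Hn nm; first by rewrite /blanks /= subn0.
rewrite [size _]/= (@exec_step _ _ _ _ (cfgL (mkstate pc 6 (n - (h == None)) j None) (Y ++ l) (h :: r))).
  by rewrite IH ?rev_cons ?cat_rcons ?subnDA //; move: Hn; rewrite blanks_cons; lia.
by rewrite step_cfgL deltaE //= (not_last Hn).
Qed.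

(** Each cell receives the symbol of its left neighbour and its own symbol is carried on; of
    [x :: Y] all is written but the last symbol, which stays in the state. *)
Lemma sweep_insert pc x Y n l r :
  pc < L.+2 -> blanks Y < n -> n <= m ->
  exec machine (size Y) (cfg (mkstate pc 2 n 0 x) l (Y ++ r))
  = cfg (mkstate pc 2 (n - blanks Y) 0 (last x Y)) (rev (belast x Y) ++ l) r.
Proof.
move=> Hpc; elim: Y n l x => [|h Y IH] n l x Hn nm; first by rewrite /blanks /= subn0.
rewrite [size _]/= (@exec_step _ _ _ _ (cfg (mkstate pc 2 (n - (h == None)) 0 h) (x :: l) (Y ++ r))).
  by rewrite IH ?rev_cons ?cat_rcons ?subnDA //; move: Hn; rewrite blanks_cons; lia.
by rewrite step_cfg deltaE //= (not_last Hn).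
Qed.

Lemma sweep_delete pc x Y n j l r :
  pc < L.+2 -> j <= m -> blanks Y < n -> n <= m ->
  exec machine (size Y) (cfgL (mkstate pc 5 n j x) (Y ++ l) r)
  = cfgL (mkstate pc 5 (n - blanks Y) j (last x Y)) l (rev (belast x Y) ++ r).
Proof.
move=> Hpc Hj; elim: Y n r x => [|h Y IH] n r x Hn nm; first by rewrite /blanks /= subn0.
rewrite [size _]/= (@exec_step _ _ _ _ (cfgL (mkstate pc 5 (n - (h == None)) j h) (Y ++ l) (x :: r))).
  by rewrite IH ?rev_cons ?cat_rcons ?subnDA //; move: Hn; rewrite blanks_cons; lia.
by rewrite step_cfgL deltaE //= (not_last Hn).
Qed.

Lemma nseq_behead z : behead (nseq z None) = nseq z.-1 None :> seq symbol.
Proof. by case: z. Qed.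

Lemma nseq_head z : head None (nseq z None) = None :> symbol.
Proof. by case: z. Qed.

Definition within b c c' := exists2 n, n <= b & exec machine n c = c'.

Lemma within_trans b1 b2 c1 c2 c3 :
  within b1 c1 c2 -> within b2 c2 c3 -> within (b1 + b2) c1 c3.
Proof.
by move=> [n1 le1 E1] [n2 le2 E2]; exists (n1 + n2); rewrite ?leq_add // execD E1.
Qed.

Lemma within_le b b' c c' : within b c c' -> b <= b' -> within b' c c'.
Proof. by case=> n le E le'; exists n => //; apply: leq_trans le'. Qed.

Lemma within_step c c' : step machine c = Some c' -> within 1 c c'.
Proof. by move=> E; exists 1 => //=; rewrite E. Qed.

Lemma within_exec n c c' : exec machine n c = c' -> within n c c'.
Proof. by exists n. Qed.

(** Besides the blanks of [Z], one more is counted: the cell to the left of the first stack. The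
    count runs out there and the head steps back to the right. The visit makes this cell part of the
    left list even if that was empty, whence [a.-1.+1]. *)
Lemma return_home pc j (Z : seq symbol) a r : pc < L.+2 -> j <= m -> (blanks Z).+1 = j ->
  within (size Z).+1
    (cfgL (mkstate pc 6 j 0 None) (rev Z ++ nseq a None) r)
    (cfg (home pc) (nseq a.-1.+1 None) (Z ++ r)).
Proof.
move=> Hpc Hj cZ; rewrite -addn1; apply: within_trans.
  by apply: within_exec; rewrite -size_rev sweep_left ?blanks_rev //; lia.
apply: within_step; rewrite step_cfgL deltaE //; last by lia.
by rewrite nseq_head nseq_behead (_ : j - _ = 1) ?revK //; lia.
Qed.

Lemma seek pc i ss1 l r : pc < L.+2 -> onth code pc = Some i ->
  index (instr_reg i) rs = size ss1 -> size ss1 <= m ->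
  within (size (flat ss1)) (cfg (home pc) l (flat ss1 ++ r))
    (cfg (mkstate pc 0 0 0 None) (rev (flat ss1) ++ l) r).
Proof.
move=> Hpc E; rewrite /home E => ->; case: ss1 => [|s ss1] le; first by exists 0.
rewrite [_ == 0]/=; set ss := s :: ss1 in le *.
have [Y EY] := @flat_rcons ss isT; have cY := count_rcons EY.
rewrite EY size_rcons -addn1 -cats1 -catA; apply: within_trans.
  apply: within_exec; rewrite sweep_right //; last by rewrite -cY.
apply: within_step; rewrite step_cfg deltaE //; last by lia.
by rewrite (_ : _ - _ = 1) ?rev_cat //; lia.
Qed.

Lemma forward pc (Y : seq symbol) ss2 j l z : pc < L.+2 -> j <= m -> size ss2 <= m -> flat ss2 = rcons Y None ->
  within (size (flat ss2)) (cfg (mkstate pc 3 (size ss2) j None) l (flat ss2 ++ nseq z None))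
    (cfgL (mkstate pc 6 m 0 None) (rev Y ++ l) (None :: nseq z None)).
Proof.
move=> Hpc Hj le EY; have cY := count_rcons EY.
rewrite EY size_rcons -addn1 -cats1 -catA; apply: within_trans.
  apply: within_exec; rewrite sweep_right //; last by rewrite -cY.
by apply: within_step; rewrite step_cfg deltaE // -?cY ?subSnn //; lia.
Qed.

Lemma within_back pc ss1 ss2 j a z : pc < L.+2 -> j <= m ->
  size (ss1 ++ ss2) = m -> 0 < size ss2 ->
  within (size (flat ss2) + size (flat (ss1 ++ ss2)))
    (cfg (mkstate pc 3 (size ss2) j None) (rev (flat ss1) ++ nseq a None) (flat ss2 ++ nseq z None))
    (cfg (home pc) (nseq a.-1.+1 None) (flat (ss1 ++ ss2) ++ nseq z None)).
Proof.
move=> Hpc Hj; rewrite size_cat => Hs s2; have [Y EY] := flat_rcons s2.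
apply: within_trans; first by apply: forward EY => //; lia.
rewrite catA -rev_cat flat_cat EY -rcons_cat size_rcons cat_rcons.
apply: return_home => //; rewrite blanks_cat count_flat -Hs -(count_rcons EY); lia.
Qed.

(** The numbers [a] and [z] of blanks listed beyond the two ends do not matter; they vary because
    visited cells are kept in the lists. *)
Definition tape pc a z ss := cfg (home pc) (nseq a None) (flat ss ++ nseq z None).

Lemma head_flat s ss r : head None (flat (s :: ss) ++ r) = ohead s.
Proof. by rewrite flat_cons; case: s. Qed.

Lemma cons_flat s ss r : ohead s :: behead (flat (s :: ss) ++ r) = flat (s :: ss) ++ r.
Proof. by rewrite flat_cons; case: s. Qed.

Section Instruction.
Variables (pc : nat) (i : instr reg) (ss1 ss2 : seq (seq bool)) (s : seq bool).
Hypotheses (Hpc : pc < L) (Hi : onth code pc = Some i).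
Hypotheses (Hss : size (ss1 ++ s :: ss2) = m) (Hj : index (instr_reg i) rs = size ss1).
Let F := size (flat (ss1 ++ s :: ss2)).

Let size2 : m - size ss1 = size (s :: ss2).
Proof. by rewrite -Hss size_cat addKn. Qed.

Let size1 : size ss1 < m.
Proof. by rewrite -Hss size_cat /=; lia. Qed.

Let FE : F = size (flat ss1) + size (flat (s :: ss2)).
Proof. by rewrite /F flat_cat size_cat. Qed.

Lemma within_seek a z : within (size (flat ss1)) (tape pc a z (ss1 ++ s :: ss2))
  (cfg (mkstate pc 0 0 0 None) (rev (flat ss1) ++ nseq a None) (flat (s :: ss2) ++ nseq z None)).
Proof.
by rewrite /tape flat_cat -catA; apply: seek Hi Hj _; lia.
Qed.

Lemma within_jump r f p a z : i = IJump r f p -> p <= L.+1 ->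
  within (4 * F + 4) (tape pc a z (ss1 ++ s :: ss2))
    (tape (if f (ohead s) then p else pc.+1) a.-1.+1 z (ss1 ++ s :: ss2)).
Proof.
move=> Ei Hp; set pc' := if _ then _ else _.
have Hpc' : pc' < L.+2 by rewrite /pc'; case: ifP => _; lia.
suff: within (size (flat ss1) + (1 + (size (flat (s :: ss2)) + F))) (tape pc a z (ss1 ++ s :: ss2))
    (tape pc' a.-1.+1 z (ss1 ++ s :: ss2)).
  by case=> n le E; exists n => //; lia.
apply: within_trans (within_seek _ _) _.
apply: within_trans (within_back (j := 0) _ _ _ _ _ _) => //.
apply: within_step; rewrite step_cfg deltaE //; last by lia.
have Hr : index r rs = size ss1 by rewrite -Hj Ei.
by rewrite /transition Hi Ei Hr size2 head_flat cons_flat.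
Qed.

(** The closing separator ends up one cell further to the right, on a formerly spare blank, whence
    [z.-1]. *)
Lemma within_push r b a z : i = IPush r b ->
  within (4 * F + 4) (tape pc a z (ss1 ++ s :: ss2)) (tape pc.+1 a.-1.+1 z.-1 (ss1 ++ (b :: s) :: ss2)).
Proof.
move=> Ei; have Hpc' : pc.+1 < L.+2 by lia.
have Hr : index r rs = size ss1 by rewrite -Hj Ei.
have [Y EY] := @flat_rcons (s :: ss2) isT; have cY := count_rcons EY.
have EF : F = size (flat ss1) + (size Y).+1 by rewrite FE EY size_rcons.
have EY' : flat (ss1 ++ (b :: s) :: ss2) = rcons (flat ss1 ++ Some b :: Y) None.
  by rewrite rcons_cat rcons_cons -EY flat_cat !flat_cons.
suff: within (size (flat ss1) + (1 + (size Y + (1 + (1 + size (flat (ss1 ++ (b :: s) :: ss2)))))))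
    (tape pc a z (ss1 ++ s :: ss2)) (tape pc.+1 a.-1.+1 z.-1 (ss1 ++ (b :: s) :: ss2)).
  case=> n le E; exists n => //; apply: leq_trans le _.
  by rewrite EY' size_rcons size_cat /=; lia.
apply: within_trans (within_seek _ _) _.
apply: within_trans.
  apply: within_step; rewrite step_cfg deltaE //; last by lia.
  rewrite /transition Hi Ei Hr size2 head_flat cons_flat.
  reflexivity.
rewrite EY -cats1 -catA; apply: within_trans.
  apply: within_exec; apply: sweep_insert => //; last by rewrite -size2 leq_subr.
  by rewrite -cY.
rewrite -cY subSnn; apply: within_trans.
  apply: within_step; rewrite step_cfg deltaE //; last by lia.
rewrite [behead _]/= -[last _ _ :: _]cat1s catA -[[:: _] ++ _]/(_ :: _) -rev_rcons -lastI.
apply: within_trans.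
  apply: within_step; rewrite step_cfg deltaE //; last by lia.
  rewrite nseq_head nseq_behead; reflexivity.
rewrite /tape EY' catA -rev_cat size_rcons cat_rcons; apply: return_home => //.
by rewrite blanks_cat blanks_cons count_flat -Hss size_cat -cY /=; lia.
Qed.

Lemma within_pop r a z : i = IPop r ->
  exists z', within (4 * F + 4) (tape pc a z (ss1 ++ s :: ss2)) (tape pc.+1 a.-1.+1 z' (ss1 ++ behead s :: ss2)).
Proof.
move=> Ei; have Hpc' : pc.+1 < L.+2 by lia.
have Hr : index r rs = size ss1 by rewrite -Hj Ei.
case Es: s => [|x s'] /=.
  rewrite -Es; exists z.
  suff: within (size (flat ss1) + (1 + (size (flat (s :: ss2)) + F))) (tape pc a z (ss1 ++ s :: ss2))
      (tape pc.+1 a.-1.+1 z (ss1 ++ s :: ss2)).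
    by case=> n le E; exists n => //; lia.
  apply: within_trans (within_seek _ _) _.
  apply: within_trans (within_back (j := size ss1) _ _ _ _ _ _) => //; last by lia.
  apply: within_step; rewrite step_cfg deltaE //; last by lia.
  by rewrite /transition Hi Ei Hr size2 head_flat cons_flat Es.
(* The deletion starts at the last blank with a carried blank, which becomes the new closing
   separator; the old one is then spare, whence [z.+1]. *)
exists z.+1; have Eo : ohead s = Some x by rewrite Es.
have [Y EY] := @flat_rcons (s' :: ss2) isT; have cY := count_rcons EY.
have EY2 : flat (s :: ss2) = Some x :: rcons Y None by rewrite -EY Es !flat_cons.
have EF : F = size (flat ss1) + (size Y).+2 by rewrite FE EY2 /= size_rcons.
have EY' : flat (ss1 ++ s' :: ss2) = rcons (flat ss1 ++ Y) None.
  by rewrite rcons_cat -EY flat_cat.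
have Hs3 : size ss2 < m by rewrite -Hss size_cat /=; lia.
have Hs2 : (blanks Y).+1 = m - size ss1 by rewrite size2.
rewrite -Es.
suff: within (size (flat ss1) + (1 + ((size Y).+1 + (1 + ((size Y).+1 + (1 + size (flat (ss1 ++ s' :: ss2))))))))
    (tape pc a z (ss1 ++ s :: ss2)) (tape pc.+1 a.-1.+1 z.+1 (ss1 ++ s' :: ss2)).
  by case=> n le E; exists n => //; rewrite EY' size_rcons size_cat in le; lia.
apply: within_trans (within_seek _ _) _.
apply: within_trans.
  apply: within_step; rewrite step_cfg deltaE //; last by lia.
  rewrite /transition Hi Ei Hr size2 head_flat cons_flat Eo /=.
  reflexivity.
rewrite EY2 -cats1 -cat_cons -catA; apply: within_trans.
  apply: within_exec; rewrite -[(size Y).+1]/(size (Some x :: Y)); apply: sweep_right => //.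
  - by lia.
  - by rewrite blanks_cons -[(size ss2).+1]/(size (s' :: ss2)) -cY.
rewrite (_ : _ - _ = 1); last by rewrite blanks_cons -[(size ss2).+1]/(size (s' :: ss2)) -cY /=; lia.
apply: within_trans.
  apply: within_step; rewrite step_cfg deltaE //; try by lia.
rewrite rev_cons [behead _]/=.
apply: within_trans.
  apply: within_exec; rewrite -[size Y]size_rev -(size_rcons _ (Some x)); apply: sweep_delete => //.
  - by lia.
  - by rewrite -cats1 blanks_cat blanks_rev /= -Hs2; lia.
  - by rewrite leq_subr.
rewrite belast_rcons last_rcons rev_cons revK -EY.
rewrite (_ : _ - _ = 1); last first.
  by rewrite -cats1 blanks_cat blanks_rev -Hs2 /=; lia.
(* The deletion stops at the blank before the stack. For the first stack this is the cell to the
   left of home, and one move to the right suffices; otherwise it is a separator, and [size ss1]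
   blanks further left remain to be counted. *)
rewrite [head _ _]/= /tape flat_cat -catA; case: (posnP (size ss1)) => [s0|s1].
  apply: (@within_le 1) => //; apply: within_step.
  rewrite step_cfgL deltaE //; try by lia.
  by rewrite (size0nil s0) /= nseq_head nseq_behead.
have [Z EZ] := flat_rcons s1; have cZ := count_rcons EZ.
apply: within_trans.
  apply: within_step; rewrite step_cfgL deltaE //; try by lia.
  rewrite EZ rev_rcons /transition /= gtn_eqF //; reflexivity.
rewrite EZ; apply: (@within_le (size Z).+1).
  by rewrite cat_rcons; apply: return_home => //; lia.
by rewrite size_cat size_rcons leq_addr.
Qed.

End Instruction.

Definition stacks (st : store reg) := [seq st r | r <- rs].

Lemma within_instr pc i st a z : uniq rs -> onth code pc = Some i -> instr_reg i \in rs ->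
  target_le L.+1 i ->
  exists a' z', within (4 * size (flat (stacks st)) + 4) (tape pc a z (stacks st))
    (tape (exec_instr i (pc, st)).1 a' z' (stacks (exec_instr i (pc, st)).2)).
Proof.
move=> Urs Hi Hr Ht.
have Hpc : pc < L by rewrite -onthTE Hi.
case/splitPr: {2}rs / (Hr) (erefl rs) => rs1 rs2 Ers.
have Est : stacks st = map st rs1 ++ st (instr_reg i) :: map st rs2.
  by rewrite /stacks Ers map_cat.
move: (Urs); rewrite Ers cat_uniq /= negb_or -!andbA => /and5P[_ N1 _ N2 _].
have Eu v : stacks (upd st (instr_reg i) v) = map st rs1 ++ v :: map st rs2.
  rewrite /stacks Ers map_cat /=; congr cat; last congr cons.
  - apply/eq_in_map => r r1; rewrite /upd; case: eqP => // E.
    by rewrite -E r1 in N1.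
  - by rewrite /upd eqxx.
  - apply/eq_in_map => r r2; rewrite /upd; case: eqP => // E.
    by rewrite -E r2 in N2.
have Hs : size (map st rs1 ++ st (instr_reg i) :: map st rs2) = m.
  by rewrite -Est size_map.
have Hj : index (instr_reg i) rs = size (map st rs1).
  by rewrite Ers index_cat (negbTE N1) /= eqxx addn0 size_map.
case: i Hi Hr Ht {Ers Urs N1 N2} Est Eu Hs Hj => [r b|r|r f p] Hi Hr Ht /= Est Eu Hs Hj.
- by rewrite Eu Est; exists a.-1.+1, z.-1; by have := within_push Hpc Hi Hs Hj a z (erefl _); apply.
- rewrite Eu Est; exists a.-1.+1; by have := within_pop Hpc Hi Hs Hj a z (erefl _); apply.
- by rewrite Est; exists a.-1.+1, z; by have := within_jump Hpc Hi Hs Hj a z (erefl _) Ht; apply.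
Qed.

Lemma size_upd_push st r b : uniq rs ->
  size (flat (stacks (upd st r (b :: st r)))) <= (size (flat (stacks st))).+1.
Proof.
rewrite !size_flat /stacks !size_map -addSn leq_add2r.
have: forall qs, uniq qs -> sumn [seq size x | x <- [seq upd st r (b :: st r) q | q <- qs]]
    <= (sumn [seq size x | x <- [seq st q | q <- qs]]).+1; last exact.
elim=> //= q qs IH /andP[Nq Uq]; rewrite {1}/upd; case: eqP => [E|_].
  rewrite /= addSn ltnS E leq_add2l (_ : map (upd _ _ _) qs = map st qs) //.
  apply/eq_in_map => r' r'q; rewrite /upd; case: eqP => // E'.
  by rewrite E -E' r'q in Nq.
by rewrite -addnS leq_add2l IH.
Qed.

Lemma size_upd_pop st r :
  size (flat (stacks (upd st r (behead (st r))))) <= size (flat (stacks st)).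
Proof.
rewrite !size_flat /stacks !size_map leq_add2r -!map_comp.
have: forall qs, sumn (map (size \o upd st r (behead (st r))) qs) <= sumn (map (size \o st) qs); last exact.
elim=> //= q qs IH; rewrite leq_add // /upd; case: eqP => [->|//].
by rewrite size_behead leq_pred.
Qed.

(** An instruction costs at most four times the length of the stacks plus four, and lengthens them
    by at most one cell, so during [n] instructions the length never exceeds the initial one plus
    [n]. *)
Lemma within_code n pc st a z : uniq rs ->
  (forall p i, onth code p = Some i -> instr_reg i \in rs /\ target_le L.+1 i) ->
  exists a' z', within (n * (4 * (size (flat (stacks st)) + n) + 4)) (tape pc a z (stacks st))
    (let: (pc', st') := iter n (step_code code) (pc, st) in tape pc' a' z' (stacks st')).
Proof.
move=> Urs Hc; elim: n pc st a z => [|n IH] pc st a z.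
  by exists a, z, 0.
case Hi: (onth code pc) => [i|]; last first.
  exists a, z; rewrite (_ : iter _ _ _ = (pc, st)); first by exists 0.
  by elim: (n.+1) => //= k ->; rewrite /step_code Hi.
have [ir it] := Hc _ _ Hi.
have [a1 [z1 W1]] := within_instr st a z Urs Hi ir it.
rewrite iterSr (_ : step_code code (pc, st) = exec_instr i (pc, st)); last by rewrite /step_code Hi.
have le1 : size (flat (stacks (exec_instr i (pc, st)).2)) <= (size (flat (stacks st))).+1.
  case: (i) => [r b|r|r f p] /=; first exact: size_upd_push.
    exact: leq_trans (size_upd_pop _ _) _.
  exact: leqnSn.
move: W1 le1; case: (exec_instr _ _) => [pc1 st1] /= W1 le1.
have [a2 [z2 W2]] := IH pc1 st1 a1 z1.
exists a2, z2; apply: within_le (within_trans W1 W2) _.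
rewrite mulSn leq_add //; first by lia.
by apply: leq_mul => //; lia.
Qed.
End Machine.

Lemma nth_flat_nil n i : nth (None : symbol) (flat (nseq n [::])) i = None.
Proof. by elim: n i => [|n IH] [|i] //=; rewrite IH. Qed.

Lemma while_machine (reg : eqType) (rin rout : reg) (c : cmd reg) :
  exists (Q : finType) (M : TM Q) (K : nat), forall w s t T,
    runs c (upd (fun=> [::]) rin w) s t -> K * (t.+2 * (size w + t.+2)) <= T ->
    halts_with M w T (ohead (s rout) == Some true).
Proof.
pose p := compile 0 c.
(* The final jump turns the top of [rout] into one of the two halting addresses: [(size p).+2]
   accepts, and falling through to [(size p).+1] rejects. *)
pose code := p ++ [:: IJump rout (fun h => h == Some true) (size p).+2].
(* With [rin] as first stack, the input word already stands where this stack belongs, and the other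
   stacks are empty. *)
pose rs := rin :: undup [seq r <- map (@instr_reg reg) code | r != rin].
have Urs : uniq rs.
  by rewrite /= undup_uniq mem_undup mem_filter eqxx.
have Lc : size code = (size p).+1 by rewrite size_cat addn1.
have Hc q i : onth code q = Some i -> instr_reg i \in rs /\ target_le (size code).+1 i.
  move=> Hi; split.
    rewrite inE mem_undup mem_filter; case: eqP => //= _; apply/onthP; exists q.
    by rewrite onth_map Hi.
  have: all (target_le (size code).+1) code.
    rewrite all_cat /= Lc leqnn !andbT; apply: target_compile; rewrite -/p; lia.
  by move/(all_nthP i)/(_ q); rewrite -onthTE Hi (onth_nth _ _ _ _ Hi); apply.
exists (state code rs), (machine code rs), (8 * (size rs).+1) => w s t T R leT.
have [|n le E] := compile_correct R (code := code) (b := 0).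
  by move=> i ip; rewrite /code onth_cat ip.
set st0 := upd _ _ _ in R E *.
set acc := (_ == _).
have {}E : iter n.+1 (step_code code) (0, st0) = (if acc then (size code).+1 else size code, s).
  rewrite iterS E add0n /step_code /= (_ : onth code _ = Some (IJump rout (fun h => h == Some true) (size p).+2)).
    by rewrite /= -/acc Lc.
  by rewrite /code onth_cat ltnn subnn.
have [a [z []]] := within_code n.+1 0 st0 0 0 Urs Hc; rewrite E => k lek Ek.
have Est : stacks rs st0 = w :: nseq (size rs).-1 [::].
  rewrite /stacks /rs /= {1}/st0 /upd eqxx; congr cons.
  apply: (@eq_from_nth _ [::]); first by rewrite size_map size_nseq.
  move=> i; rewrite size_map => ir; rewrite nth_nseq if_same (nth_map rin) //.
  rewrite /st0 /upd; case: eqP => // Ei; have := mem_nth rin ir.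
  by rewrite Ei mem_undup mem_filter eqxx.
have Hs : sim_config (init_config (machine code rs) w) (tape code rs 0 0 0 (stacks rs st0)).
  rewrite Est /tape flat_cons -catA; case: (w) => [|b w'] /=; split => //= i.
    by rewrite cats0 nth_flat_nil nth_nil.
  rewrite !nth_cat size_map; case: ltnP => // le'.
  rewrite nth_default ?size_map //; case: (i - _) => //= i'.
  by rewrite cats0 nth_flat_nil.
have [Hq Hr] := sim_exec (machine code rs) k Hs; rewrite Ek in Hq Hr.
set pc := (if acc then _ else _) in Ek Hq Hr E.
have Hpc : pc < (size code).+2 by rewrite /pc; case: ifP.
have Hhome : home code rs pc = mkstate code rs pc 0 0 0 None.
  by rewrite /home onth_default // /pc; case: ifP.
have Hh : halted (machine code rs) (exec (machine code rs) k (init_config (machine code rs) w)).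
  case: (exec _ _ _) Hq => [[[q l] h] r] [-> _ ->].
  by rewrite /halted Hhome deltaE // /transition onth_default // /pc; case: ifP.
have kT : k <= T.
  apply: leq_trans lek (leq_trans _ leT).
  rewrite Est size_flat /= map_nseq sumn_nseq mul0n addn0 size_nseq.
  set S := size (undup _); set W := size w.
  apply: (@leq_trans (t.+2 * (4 * (W + S.+1 + t.+1) + 4))).
    by apply: leq_mul; lia.
  by rewrite mulnCA leq_mul2l /=; nia.
rewrite /halts_with (exec_halted Hh kT); split => //.
have -> : (exec (machine code rs) k (init_config (machine code rs) w)).1.1.1 = home code rs pc.
  by rewrite Hq.
rewrite Hhome /= inordK // /pc; case: (acc); first by rewrite eqxx.
by rewrite -[RHS](ltn_eqF (ltnSn (size code))).
Qed.

(** * Evaluating iterated first-order definitions *)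

Definition ident := (nat * nat)%type.

(** The atom [Le] contains sums because unary numbers are parsed by relations such as q = p + x + 1
    between positions; equality is derived from it. *)
Inductive form :=
  | Le of nat & seq ident & ident
  | Rel of ident & seq ident
  | And of form & form
  | Not of form
  | Ex of ident & form.

(* [Tab j xs a] puts the truth table of [a] as a relation of [xs] into table [j],
   on top of the old one, which lookups with values below [N] no longer reach. *)
Inductive prog :=
  | Tab of ident & seq ident & form
  | Then of prog & prog
  | For of ident & prog.

Definition env := ident -> nat.
Definition tables := ident -> seq bool.

(** Base [N] with the first argument most significant, which is the order in which nested loops
    enumerate a truth table. *)
Fixpoint index_of N (xs : seq nat) :=
  if xs is x :: xs' then x * N ^ size xs' + index_of N xs' else 0.

Fixpoint sem N (T : tables) (e : env) (a : form) : bool :=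
  match a with
  | Le c xs y => c + sumn (map e xs) <= e y
  | Rel j xs => nth false (T j) (index_of N (map e xs))
  | And a b => sem N T e a && sem N T e b
  | Not a => ~~ sem N T e a
  | Ex x a => has (fun i => sem N T (upd e x i) a) (iota 0 N)
  end.

Fixpoint table N T e xs a : seq bool :=
  if xs is x :: xs' then flatten [seq table N T (upd e x i) xs' a | i <- iota 0 N]
  else [:: sem N T e a].

Fixpoint psem N e p T : tables :=
  match p with
  | Tab j xs a => upd T j (table N T e xs a ++ T j)
  | Then p q => psem N e q (psem N e p T)
  | For x p => foldl (fun T i => psem N (upd e x i) p T) T (iota 0 N)
  end.

Fixpoint fvars (a : form) : seq ident :=
  match a with
  | Le _ xs y => y :: xs
  | Rel _ xs => xs
  | And a b => fvars a ++ fvars b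
  | Not a => fvars a
  | Ex x a => x :: fvars a
  end.

Fixpoint pvars p :=
  match p with
  | Tab _ xs a => xs ++ fvars a
  | Then p q => pvars p ++ pvars q
  | For x p => x :: pvars p
  end.

Lemma upd_same (A : eqType) B (f : A -> B) a x : upd f a x a = x.
Proof. by rewrite /upd eqxx. Qed.

Lemma upd_other (A : eqType) B (f : A -> B) a b x : b != a -> upd f a x b = f b.
Proof. by rewrite /upd => /negbTE->. Qed.

Lemma upd_upd (A : eqType) B (f : A -> B) a x y : upd (upd f a x) a y = upd f a y.
Proof. by apply: functional_extensionality => b; rewrite /upd; case: eqP. Qed.

Lemma upd_id (A : eqType) B (f : A -> B) a : upd f a (f a) = f.
Proof. by apply: functional_extensionality => b; rewrite /upd; case: eqP => [->|]. Qed.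

Ltac polyb_tac :=
  do ![apply: polyb_add | apply: polyb_mul | apply: polyb_exp | apply: polyb_const | apply: polyb_id | assumption].

Section Compiler.
Variable vs : seq ident.
Hypothesis v0_vs : (0, 0) \in vs.

Definition regT := (nat * ident)%type.
(* Variable [x] of value [i] is kept as the unary stacks [V x] of size [i] and
   [U x] of size [N - i]; table [j] is the zipper [Lf j], [Rt j]; [G] saves
   values of variables, [R] holds truth values, [D] is scratch. *)
Definition V x : regT := (0, x).
Definition U x : regT := (1, x).
Definition Lf j : regT := (2, j).
Definition Rt j : regT := (3, j).
Definition G : regT := (4, (0, 0)).
Definition R : regT := (5, (0, 0)).
Definition D : regT := (6, (0, 0)).

Record mem := Mem { lf : tables; rt : tables; res : seq bool; scr : seq bool }.

(** Outside [vs] the complement stack is empty, since loading the input fills [U x] only for the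
    variables in [vs]. *)
Definition st N (e : env) (g : seq bool) (m : mem) : store regT := fun r =>
  match r.1 with
  | 0 => nseq (e r.2) true
  | 1 => if r.2 \in vs then nseq (N - e r.2) true else [::]
  | 2 => lf m r.2
  | 3 => rt m r.2
  | 4 => if r.2 == (0, 0) then g else [::]
  | 5 => if r.2 == (0, 0) then res m else [::]
  | 6 => if r.2 == (0, 0) then scr m else [::]
  | _ => [::]
  end.

Ltac state_eq :=
  apply: functional_extensionality => -[[|[|[|[|[|[|[|?]]]]]]] ?];
  rewrite /upd /st ?xpair_eqE //=; try by case: eqP.

Lemma st_G N e g m g' : upd (st N e g m) G g' = st N e g' m.
Proof. state_eq. Qed.

Lemma st_R N e g m r : upd (st N e g m) R r = st N e g (Mem (lf m) (rt m) r (scr m)).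
Proof. state_eq. Qed.

Lemma st_D N e g m d : upd (st N e g m) D d = st N e g (Mem (lf m) (rt m) (res m) d).
Proof. state_eq. Qed.

Lemma st_Lf N e g m j l : upd (st N e g m) (Lf j) l = st N e g (Mem (upd (lf m) j l) (rt m) (res m) (scr m)).
Proof. state_eq. Qed.

Lemma st_Rt N e g m j l : upd (st N e g m) (Rt j) l = st N e g (Mem (lf m) (upd (rt m) j l) (res m) (scr m)).
Proof. state_eq. Qed.

Lemma st_VU N e g m x i : x \in vs ->
  upd (upd (st N e g m) (V x) (nseq i true)) (U x) (nseq (N - i) true) = st N (upd e x i) g m.
Proof. by move=> xvs; state_eq; case: eqP => [->|] //; rewrite xvs. Qed.

Lemma st_UV N e g m x i : x \in vs ->
  upd (upd (st N e g m) (U x) (nseq (N - i) true)) (V x) (nseq i true) = st N (upd e x i) g m.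
Proof. by move=> xvs; state_eq; case: eqP => [->|] //; rewrite xvs. Qed.

Notation "c ;; d" := (Seq c d) (at level 61, left associativity).

(** * Loops over unary counters *)

Definition is_true_top (h : option bool) := h == Some true.

Definition dec x := Pop (V x) ;; Push (U x) true.
Definition inc x := Pop (U x) ;; Push (V x) true.

Lemma runs_dec N e g m x : x \in vs -> 0 < e x <= N ->
  runs (dec x) (st N e g m) (st N (upd e x (e x).-1) g m) 2.
Proof.
move=> xvs /andP[x0 xN]; rewrite -st_VU //.
have E : nseq (e x).-1 true = behead (st N e g m (V x)) by rewrite /st /=; case: (e x) x0.
have E' : nseq (N - (e x).-1) true = true :: upd (st N e g m) (V x) (nseq (e x).-1 true) (U x).
  by rewrite /upd /st /= xvs -[_ :: _]/(nseq (N - e x).+1 true); congr nseq; lia.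
rewrite E' E; exact: (runs_seq (runs_pop _ _) (runs_push _ _ _)).
Qed.

Lemma runs_inc N e g m x : x \in vs -> e x < N ->
  runs (inc x) (st N e g m) (st N (upd e x (e x).+1) g m) 2.
Proof.
move=> xvs xN; rewrite -st_UV //.
have E : nseq (N - (e x).+1) true = behead (st N e g m (U x)).
  by rewrite /st /= xvs (_ : N - e x = (N - (e x).+1).+1) //; lia.
have E' : nseq (e x).+1 true = true :: upd (st N e g m) (U x) (nseq (N - (e x).+1) true) (V x).
  by rewrite /upd /st /=.
rewrite E' E; exact: (runs_seq (runs_pop _ _) (runs_push _ _ _)).
Qed.

(** The bits [true] put on [G] above a [false] record the consumed value, and [up] restores it. As
    the saved values form a stack, loops can be nested, even over the same variable. *)
Definition down x c := Push G false ;; While (V x) isSome (dec x ;; Push G true ;; c).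
Definition up x := While G is_true_top (Pop G ;; inc x) ;; Pop G.
Definition foreach x c := down x c ;; up x.
Definition floop x c :=
  down x (Skip _) ;; While (U x) isSome (c ;; inc x) ;;
  While (V x) isSome (dec x) ;; up x.

Lemma runs_Gpush N e g m b : runs (Push G b) (st N e g m) (st N e (b :: g) m) 1.
Proof. by rewrite -[st N e (_ :: _) m](st_G N e g); apply: runs_push. Qed.

Lemma runs_Gpop N e g m : runs (Pop G) (st N e g m) (st N e (behead g) m) 1.
Proof. by rewrite -[st N e (behead _) m](st_G N e g); apply: runs_pop. Qed.

Lemma runs_Rpush N e g T T' r d b : runs (Push R b) (st N e g (Mem T T' r d)) (st N e g (Mem T T' (b :: r) d)) 1.
Proof. by have := runs_push R b (st N e g (Mem T T' r d)); rewrite st_R. Qed.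

Lemma runs_Rpop N e g T T' r d : runs (Pop R) (st N e g (Mem T T' r d)) (st N e g (Mem T T' (behead r) d)) 1.
Proof. by have := runs_pop R (st N e g (Mem T T' r d)); rewrite st_R. Qed.

Lemma runs_Dpush N e g T T' r d b : runs (Push D b) (st N e g (Mem T T' r d)) (st N e g (Mem T T' r (b :: d))) 1.
Proof. by have := runs_push D b (st N e g (Mem T T' r d)); rewrite st_D. Qed.

Lemma runs_Dpop N e g T T' r d : runs (Pop D) (st N e g (Mem T T' r d)) (st N e g (Mem T T' r (behead d))) 1.
Proof. by have := runs_pop D (st N e g (Mem T T' r d)); rewrite st_D. Qed.

Lemma runs_up N e g m x k : x \in vs -> e x + k <= N ->
  runs (up x) (st N e (nseq k true ++ false :: g) m) (st N (upd e x (e x + k)) g m) (5 * k + 2).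
Proof.
move=> xvs le; apply: (@runs_le _ _ _ _ ((5 * k + 1) + 1)); last by lia.
apply: runs_seq; last exact: (runs_Gpop N _ (false :: g)).
elim: k e le => [|k IH] e le.
  by rewrite addn0 upd_id /=; apply: runs_while_stop.
apply: (@runs_le _ _ _ _ ((1 + 2) + (5 * k + 1) + 2)); last by lia.
apply: runs_while_go => //.
  apply: runs_seq; first exact: runs_Gpop.
  by apply: runs_inc => //; lia.
have := IH (upd e x (e x).+1); rewrite upd_upd upd_same addSnnS; apply; lia.
Qed.

(** The family [m] is the loop invariant: [m i] is the memory after [i] rounds. The body has to work
    for every content [g'] of [G], which grows during the loop. *)
Lemma runs_down N e g (m : nat -> mem) x c t : x \in vs -> e x <= N ->
  (forall i g', i < e x -> runs c (st N (upd e x (e x - i.+1)) g' (m i)) (st N (upd e x (e x - i.+1)) g' (m i.+1)) t) ->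
  runs (down x c) (st N e g (m 0)) (st N (upd e x 0) (nseq (e x) true ++ false :: g) (m (e x)))
    ((t + 6) * e x + 2).
Proof.
move=> xvs le H; apply: (@runs_le _ _ _ _ (1 + ((t + 6) * e x + 1))); last by lia.
apply: runs_seq; first exact: runs_Gpush.
have: forall k, k <= e x -> runs (While (V x) isSome (dec x ;; Push G true ;; c))
  (st N (upd e x k) (nseq (e x - k) true ++ false :: g) (m (e x - k)))
  (st N (upd e x 0) (nseq (e x) true ++ false :: g) (m (e x))) ((t + 6) * k + 1).
  elim=> [|k IH] lek.
    by rewrite subn0 muln0; apply: runs_while_stop; rewrite /st /= upd_same.
  apply: (@runs_le _ _ _ _ ((2 + 1 + t) + ((t + 6) * k + 1) + 2)); last by lia.
  apply: runs_while_go (IH (ltnW lek)); first by rewrite /st /= upd_same.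
  apply: runs_seq.
    apply: runs_seq.
      by apply: runs_dec; rewrite // upd_same; lia.
    exact: runs_Gpush.
  rewrite upd_same upd_upd /= -[true :: _]/(nseq (e x - k.+1).+1 true ++ _).
  rewrite (_ : (e x - k.+1).+1 = e x - k); last by lia.
  have := H (e x - k.+1) (nseq (e x - k) true ++ false :: g).
  rewrite (_ : (e x - k.+1).+1 = e x - k); last by lia.
  by rewrite (_ : e x - (e x - k) = k); [apply; lia | lia].
by move=> /(_ (e x) (leqnn _)); rewrite subnn upd_id.
Qed.

Lemma runs_foreach N e g (m : nat -> mem) x c t : x \in vs -> e x <= N ->
  (forall i g', i < e x -> runs c (st N (upd e x (e x - i.+1)) g' (m i)) (st N (upd e x (e x - i.+1)) g' (m i.+1)) t) ->
  runs (foreach x c) (st N e g (m 0)) (st N e g (m (e x))) ((t + 11) * N + 4).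
Proof.
move=> xvs le H; apply: (@runs_le _ _ _ _ (((t + 6) * e x + 2) + (5 * e x + 2))); last by nia.
apply: runs_seq; first exact: runs_down.
by have := @runs_up N (upd e x 0) g (m (e x)) x (e x) xvs; rewrite upd_same add0n upd_upd upd_id; apply.
Qed.

Lemma runs_floop N e g (m : nat -> mem) x c t : x \in vs -> e x <= N ->
  (forall i g', i < N -> runs c (st N (upd e x i) g' (m i)) (st N (upd e x i) g' (m i.+1)) t) ->
  runs (floop x c) (st N e g (m 0)) (st N e g (m N)) ((t + 20) * N + 6).
Proof.
move=> xvs le H.
apply: (@runs_le _ _ _ _ (((0 + 6) * e x + 2) + ((t + 4) * N + 1) + (4 * N + 1) + (5 * e x + 2))); last by nia.
set g' := nseq (e x) true ++ false :: g.
apply: (@runs_seq _ _ _ _ (st N (upd e x 0) g' (m N))); last first.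
  by have := @runs_up N (upd e x 0) g (m N) x (e x) xvs; rewrite upd_same add0n upd_upd upd_id; apply.
apply: (@runs_seq _ _ _ _ (st N (upd e x N) g' (m N))); last first.
  have: forall k, k <= N -> runs (While (V x) isSome (dec x)) (st N (upd e x k) g' (m N))
      (st N (upd e x 0) g' (m N)) (4 * k + 1).
    elim=> [|k IH] lek.
      by apply: runs_while_stop; rewrite /st /= upd_same.
    apply: (@runs_le _ _ _ _ (2 + (4 * k + 1) + 2)); last by lia.
    apply: runs_while_go (IH (ltnW lek)); first by rewrite /st /= upd_same.
    by have := @runs_dec N (upd e x k.+1) g' (m N) x xvs; rewrite upd_same upd_upd /=; apply.
  by apply.
apply: (@runs_seq _ _ _ _ (st N (upd e x 0) g' (m 0))).
  apply: (@runs_down N e g (fun=> m 0) x (Skip _) 0) => // *; exact: runs_skip.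
have: forall k, k <= N -> runs (While (U x) isSome (c ;; inc x)) (st N (upd e x (N - k)) g' (m (N - k)))
      (st N (upd e x N) g' (m N)) ((t + 4) * k + 1).
  elim=> [|k IH] lek.
    by rewrite subn0 muln0; apply: runs_while_stop; rewrite /st /= upd_same xvs subnn.
  apply: (@runs_le _ _ _ _ ((t + 2) + ((t + 4) * k + 1) + 2)); last by lia.
  apply: runs_while_go (IH (ltnW lek)).
    rewrite /st /= upd_same xvs.
    by rewrite (_ : N - _ = k.+1); last by lia.
  apply: runs_seq; first by apply: H; lia.
  have := @runs_inc N (upd e x (N - k.+1)) g' (m (N - k)) x xvs; rewrite upd_same upd_upd /=.
  by rewrite (_ : (N - k.+1).+1 = N - k); [apply; lia | lia].
by move=> /(_ N (leqnn N)); rewrite subnn.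
Qed.


(** * Looking up an entry of a table *)

Definition move_top (a b : regT) :=
  If a is_true_top (Pop a ;; Push b true)
    (If a (fun h => h == Some false) (Pop a ;; Push b false) (Skip _)).

Definition shift j n m := Mem (upd (lf m) j (drop n (lf m j)))
  (upd (rt m) j (rev (take n (lf m j)) ++ rt m j)) (res m) (scr m).

Lemma shift0 j m : shift j 0 m = m.
Proof. by case: m => *; rewrite /shift /= drop0 take0 !upd_id. Qed.

Lemma shift_shift j n1 n2 m : shift j n2 (shift j n1 m) = shift j (n1 + n2) m.
Proof.
by rewrite /shift /= !upd_same !upd_upd drop_drop takeD rev_cat catA addnC.
Qed.

Lemma runs_move_cons a b x l s : s a = x :: l ->
  runs (move_top a b) s (upd (upd s a l) b (x :: upd s a l b)) 6.
Proof.
move=> E; have H : runs (Pop a ;; Push b x) s (upd (upd s a l) b (x :: upd s a l b)) 2.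
  by have := runs_seq (runs_pop a s) (runs_push b x _); rewrite E.
apply: (@runs_le _ _ _ _ (2 + 2 + 2)) => //.
case: x E H => E H; do ?[apply: runs_if; rewrite E /=] => //.
exact: runs_le H _.
Qed.

Lemma runs_move_nil a b s : s a = [::] -> runs (move_top a b) s s 6.
Proof.
move=> E; apply: (@runs_le _ _ _ _ (0 + 2 + 2)) => //.
by do 2![apply: runs_if; rewrite E /=]; apply: runs_skip.
Qed.

Lemma runs_shift N e g m j :
  runs (move_top (Lf j) (Rt j)) (st N e g m) (st N e g (shift j 1 m)) 6.
Proof.
case: m => T T' r d; rewrite /shift [lf _]/= [rt _]/=; case E: (T j) => [|b l].
  have -> : upd T j (drop 1 [::]) = T by rewrite -[drop 1 _]E upd_id.
  by rewrite upd_id; apply: runs_move_nil.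
have := @runs_move_cons (Lf j) (Rt j) b l (st N e g (Mem T T' r d)) E.
by rewrite st_Lf st_Rt /= drop0 take0.
Qed.

(** All levels use the one counter [(0, 0)], which each loop saves and restores; this is why
    [(0, 0)] has to belong to [vs]. *)
Fixpoint skip p j :=
  if p is p'.+1 then floop (0, 0) (skip p' j) else move_top (Lf j) (Rt j).

Lemma runs_skipping p : exists2 f, polyb f & forall j N e g m, (forall x, e x <= N) ->
  runs (skip p j) (st N e g m) (st N e g (shift j (N ^ p) m)) (f N).
Proof.
elim: p => [|p [f Pf IH]].
  by exists (fun=> 6) => [|*]; [apply: polyb_const | apply: runs_shift].
exists (fun N => (f N + 20) * N + 6) => [|j N e g m He].
  by do ![apply: polyb_add | apply: polyb_mul | apply: polyb_const | apply: polyb_id | assumption].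
have := @runs_floop N e g (fun i => shift j (i * N ^ p) m) (0, 0) (skip p j) (f N) v0_vs (He _).
rewrite shift0 expnS; apply => i g' iN.
rewrite mulSn addnC -shift_shift; apply: IH => x; rewrite /upd; case: eqP => // _; exact: ltnW.
Qed.

Fixpoint seek_index j xs :=
  if xs is x :: xs' then foreach x (skip (size xs') j) ;; seek_index j xs' else Skip _.

Definition lookup j xs :=
  seek_index j xs ;; If (Lf j) is_true_top (Push R true) (Push R false) ;;
  While (Rt j) isSome (move_top (Rt j) (Lf j)).


Lemma runs_seek xs : {subset xs <= vs} -> exists2 f, polyb f & forall j N e g m, (forall x, e x <= N) ->
  runs (seek_index j xs) (st N e g m) (st N e g (shift j (index_of N (map e xs)) m)) (f N).
Proof.
elim: xs => [_|x xs IH sub].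
  by exists (fun=> 0) => [|*]; [apply: polyb_const | rewrite shift0; apply: runs_skip].
have [|f Pf Hf] := IH; first by move=> y yxs; apply: sub; rewrite inE yxs orbT.
have [h Ph Hh] := runs_skipping (size xs).
exists (fun N => ((h N + 11) * N + 4) + f N) => [|j N e g m He].
  by do ![apply: polyb_add | apply: polyb_mul | apply: polyb_const | apply: polyb_id | assumption].
apply: runs_seq; last by rewrite /= -shift_shift; apply: Hf.
have xvs : x \in vs by apply: sub; rewrite inE eqxx.
have := @runs_foreach N e g (fun i => shift j (i * N ^ size xs) m) x (skip (size xs) j) (h N) xvs (He _).
rewrite shift0 size_map; apply => i g' iN.
rewrite mulSn addnC -shift_shift; apply: Hh => y; rewrite /upd; case: eqP => // _.
by rewrite (leq_trans (leq_subr _ _)).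
Qed.

Lemma index_of_bound N xs : (forall x, x \in xs -> x <= N) -> index_of N xs <= size xs * N.+1 ^ size xs.
Proof.
elim: xs => //= x xs IH H; rewrite mulSn leq_add //.
  rewrite expnS leq_mul //; first by rewrite leqW // H // inE eqxx.
  by case: (size xs) => // n; rewrite leq_exp2r.
apply: leq_trans (IH _) _; first by move=> y yxs; apply: H; rewrite inE yxs orbT.
by rewrite leq_mul2l leq_pexp2l ?orbT.
Qed.

Definition none : tables := fun=> [::].

Lemma runs_rewind N e g j l b T r d :
  runs (While (Rt j) isSome (move_top (Rt j) (Lf j)))
    (st N e g (Mem (upd T j l) (upd none j b) r d)) (st N e g (Mem (upd T j (rev b ++ l)) none r d)) (8 * size b + 1).
Proof.
elim: b l => [|x b IH] l.
  by rewrite (upd_id none j : upd none j [::] = none); apply: runs_while_stop.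
have E : st N e g (Mem (upd T j l) (upd none j (x :: b)) r d) (Rt j) = x :: b.
  by rewrite /st /= upd_same.
have := runs_move_cons (Lf j) E; rewrite st_Rt st_Lf /= !upd_upd.
rewrite {3}/st /= upd_same => H.
apply: (@runs_le _ _ _ _ (6 + (8 * size b + 1) + 2)); last by rewrite /=; lia.
apply: (runs_while_go _ H); first by rewrite E.
by rewrite rev_cons cat_rcons; apply: IH.
Qed.

Lemma runs_lookup j xs : {subset xs <= vs} -> exists2 f, polyb f & forall N e g T r d, (forall x, e x <= N) ->
  runs (lookup j xs) (st N e g (Mem T none r d))
    (st N e g (Mem T none (nth false (T j) (index_of N (map e xs)) :: r) d)) (f N).
Proof.
move=> sub; have [f Pf Hf] := runs_seek sub.
exists (fun N => f N + 3 + (8 * (size xs * (N + 1) ^ size xs) + 1)) => [|N e g T r d He].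
  do ![apply: polyb_add | apply: polyb_mul | apply: polyb_exp | apply: polyb_const | apply: polyb_id | assumption].
set k := index_of _ _.
have lek : k <= size xs * (N + 1) ^ size xs.
  rewrite addn1 -{1}(size_map e) -(size_map e xs); apply: index_of_bound => _ /mapP[x _ ->]; exact: He.
apply: (@runs_le _ _ _ _ (f N + 3 + (8 * size (rev (take k (T j))) + 1))); last first.
  rewrite size_rev leq_add2l leq_add2r leq_mul2l; apply/orP; right; apply: leq_trans lek.
  by rewrite size_take_min geq_minl.
apply: runs_seq.
  apply: runs_seq; first exact: Hf.
  apply: (@runs_if _ _ _ _ _ _ _ 1); rewrite {1}/st /= upd_same.
  rewrite /shift /= cats0 (_ : (if _ then _ else _) = Push R (nth false (T j) k)).
    exact: runs_Rpush.
  by rewrite -[in RHS](addn0 k) -nth_drop; case: (drop k _) => [|[]].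
by have := runs_rewind N e g j (drop k (T j)) (rev (take k (T j))) T (nth false (T j) k :: r) d;
  rewrite revK cat_take_drop upd_id.
Qed.

(** * Compiling formulas and table programs *)

Fixpoint push_const c := if c is c'.+1 then push_const c' ;; Push D true else Skip _.

Fixpoint push_sum xs := if xs is x :: xs' then push_sum xs' ;; foreach x (Push D true) else Skip _.

Lemma runs_push_const c N e g T r :
  runs (push_const c) (st N e g (Mem T none r [::])) (st N e g (Mem T none r (nseq c true))) c.
Proof.
elim: c => [|c IH] /=; first exact: runs_skip.
by rewrite -[in X in runs _ _ _ X]addn1; apply: runs_seq IH (runs_Dpush _ _ _ _ _ _ _ _).
Qed.

Lemma runs_push_sum xs N e g T r d : {subset xs <= vs} -> (forall x, e x <= N) ->
  runs (push_sum xs) (st N e g (Mem T none r (nseq d true)))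
    (st N e g (Mem T none r (nseq (d + sumn (map e xs)) true))) ((12 * N + 4) * size xs).
Proof.
move=> sub He; elim: xs sub => [|x xs IH] sub /=; first by rewrite addn0; apply: runs_le (runs_skip _) _.
rewrite mulnS [X in runs _ _ _ X]addnC; apply: runs_seq; first by apply: IH => y yxs; apply: sub; rewrite inE yxs orbT.
have xvs : x \in vs by apply: sub; rewrite inE eqxx.
have := @runs_foreach N e g (fun i => Mem T none r (nseq (d + sumn (map e xs) + i) true)) x (Push D true) 1 xvs (He x).
rewrite addn0 (addnC (e x)) addnA; apply => i g' _; rewrite addnS; exact: runs_Dpush.
Qed.

(** For [Le] the left side is written on [D] in unary and [e y] pops follow. Popping an empty stack
    does nothing, so [D] becomes empty exactly when the inequality holds. For [Ex] the top of [R]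
    tells whether a witness has been found; if so, the remaining rounds do nothing. *)
Fixpoint cform (a : form) : cmd regT :=
  match a with
  | Le c xs y => push_const c ;; push_sum xs ;; foreach y (Pop D) ;;
      If D isSome (Push R false) (Push R true) ;; While D isSome (Pop D)
  | Rel j xs => lookup j xs
  | And a b => cform a ;; If R is_true_top (Pop R ;; cform b) (Skip _)
  | Not a => cform a ;; If R is_true_top (Pop R ;; Push R false) (Pop R ;; Push R true)
  | Ex x a => Push R false ;; floop x (If R is_true_top (Skip _) (Pop R ;; cform a))
  end.

Lemma iota0S n : iota 0 n.+1 = rcons (iota 0 n) n.
Proof. by rewrite -addn1 iotaD cats1. Qed.

Lemma env_upd N (e : env) x i : (forall y, e y <= N) -> i <= N -> forall y, upd e x i y <= N.
Proof. by move=> He iN y; rewrite /upd; case: eqP. Qed.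

Lemma runs_form a : {subset fvars a <= vs} -> exists2 f, polyb f & forall N e g T r,
  (forall x, e x <= N) ->
  runs (cform a) (st N e g (Mem T none r [::])) (st N e g (Mem T none (sem N T e a :: r) [::])) (f N).
Proof.
elim: a => [c xs y|j xs|a IHa b IHb|a IH|x a IH] sub /=.
- have yvs : y \in vs by apply: sub; rewrite inE eqxx.
  have xvs : {subset xs <= vs} by move=> x xxs; apply: sub; rewrite inE xxs orbT.
  pose k e := c + sumn (map e xs).
  exists (fun N => (c + (12 * N + 4) * size xs + (12 * N + 4)) + 3 + (3 * (c + N * size xs) + 1)) => [|N e g T r He]; first by polyb_tac.
  have le : k e <= c + N * size xs.
    rewrite leq_add2l; elim: (xs) => //= x l IH; by rewrite mulnS leq_add.
  apply: (@runs_le _ _ _ _ ((c + (12 * N + 4) * size xs + (12 * N + 4)) + 3 + (3 * (k e - e y) + 1))); last by lia.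
  apply: (@runs_seq _ _ _ _ (st N e g (Mem T none ((k e <= e y) :: r) (nseq (k e - e y) true)))); last first.
    elim: (k e - e y) => [|d IH]; first exact: runs_while_stop.
    apply: (@runs_le _ _ _ _ (1 + (3 * d + 1) + 2)); last by lia.
    by apply: runs_while_go IH => //; exact: runs_Dpop.
  apply: (@runs_seq _ _ _ _ (st N e g (Mem T none r (nseq (k e - e y) true)))); last first.
    apply: (@runs_if _ _ _ _ _ _ _ 1).
    rewrite (_ : (if _ then _ else _) = Push R (k e <= e y)); first exact: runs_Rpush.
    by rewrite /st /= -subn_eq0; case: (k e - e y).
  apply: (@runs_seq _ _ _ _ (st N e g (Mem T none r (nseq (k e) true)))).
    by apply: runs_seq; [apply: runs_push_const | apply: runs_push_sum].
  have := @runs_foreach N e g (fun i => Mem T none r (nseq (k e - i) true)) y (Pop D) 1 yvs (He y).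
  rewrite subn0; apply => i g' _.
  have := runs_Dpop N (upd e y (e y - i.+1)) g' T none r (nseq (k e - i) true).
  by rewrite [k e - i.+1]subnS; case: (k e - i).
- have [f Pf Hf] := runs_lookup j sub.
  by exists f => // N e g T r He; apply: Hf.
- have [|f Pf Hf] := IHa; first by move=> y yv; apply: sub; rewrite mem_cat yv.
  have [|h Ph Hh] := IHb; first by move=> y yv; apply: sub; rewrite mem_cat yv orbT.
  exists (fun N => f N + (1 + h N + 2)) => [|N e g T r He]; first by polyb_tac.
  apply: runs_seq; first exact: Hf.
  apply: runs_if; rewrite {1}/st /=; case: (sem N T e a) => /=.
    by apply: runs_seq; [exact: runs_Rpop | exact: Hh].
  by apply: runs_le (runs_skip _) _.
- have [|f Pf Hf] := IH; first exact: sub.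
  exists (fun N => f N + (2 + 2)) => [|N e g T r He]; first by polyb_tac.
  apply: runs_seq; first exact: Hf.
  by apply: runs_if; rewrite {1}/st /=; case: (sem N T e a) => /=;
    apply: (runs_seq (runs_Rpop _ _ _ _ _ _ _) (runs_Rpush _ _ _ _ _ _ _ _)).
- have [|f Pf Hf] := IH; first by move=> y yv; apply: sub; rewrite inE yv orbT.
  have xvs : x \in vs by apply: sub; rewrite inE eqxx.
  exists (fun N => 1 + ((1 + f N + 2 + 20) * N + 6)) => [|N e g T r He]; first by polyb_tac.
  apply: runs_seq; first exact: runs_Rpush.
  apply: (@runs_floop N e g (fun k => Mem T none (has (fun i => sem N T (upd e x i) a) (iota 0 k) :: r) [::])) => // i g' iN.
  cbv beta; apply: runs_if; rewrite iota0S has_rcons orbC {1}/st /=.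
  case: (has _ _) => /=; first by apply: runs_le (runs_skip _) _.
  apply: runs_seq; first exact: runs_Rpop.
  by apply: Hf; apply: env_upd => //; apply: ltnW.
Qed.

(** All truth values are collected on [R] before any is stored, so the whole new table is computed
    from the old one. They lie on [R] in reverse order, which the transfer to [Lf j] undoes. *)
Fixpoint ctable xs a :=
  if xs is x :: xs' then floop x (ctable xs' a) else cform a.

Fixpoint cprog p :=
  match p with
  | Tab j xs a => ctable xs a ;; While R isSome (move_top R (Lf j))
  | Then p q => cprog p ;; cprog q
  | For x p => floop x (cprog p)
  end.

Lemma size_table N T e xs a : size (table N T e xs a) = N ^ size xs.
Proof.
elim: xs e => //= x xs IH e.
suff H s : size (flatten [seq table N T (upd e x i) xs a | i <- s]) = size s * N ^ size xs.
  by rewrite H size_iota expnS.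
by elim: s => //= i s IHs; rewrite size_cat IH IHs mulSn.
Qed.

Lemma runs_table xs a : {subset xs ++ fvars a <= vs} -> exists2 f, polyb f & forall N e g T r,
  (forall x, e x <= N) ->
  runs (ctable xs a) (st N e g (Mem T none r [::]))
    (st N e g (Mem T none (rev (table N T e xs a) ++ r) [::])) (f N).
Proof.
elim: xs => [|x xs IH] sub; first exact: runs_form.
have [|f Pf Hf] := IH; first by move=> y yv; apply: sub; rewrite inE yv orbT.
have xvs : x \in vs by apply: sub; rewrite inE eqxx.
exists (fun N => (f N + 20) * N + 6) => [|N e g T r He]; first by polyb_tac.
apply: (@runs_floop N e g (fun k => Mem T none (rev (flatten [seq table N T (upd e x i) xs a | i <- iota 0 k]) ++ r) [::])) => // i g' iN.
cbv beta; rewrite iota0S map_rcons flatten_rcons rev_cat -catA.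
by apply: Hf; apply: env_upd => //; apply: ltnW.
Qed.

Lemma runs_prog p : {subset pvars p <= vs} -> exists2 f, polyb f & forall N e g T,
  (forall x, e x <= N) ->
  runs (cprog p) (st N e g (Mem T none [::] [::])) (st N e g (Mem (psem N e p T) none [::] [::])) (f N).
Proof.
elim: p => [j xs a|p IHp q IHq|x p IH] sub /=.
- have [f Pf Hf] := runs_table sub.
  exists (fun N => f N + (8 * N ^ size xs + 1)) => [|N e g T He]; first by polyb_tac.
  apply: runs_seq; first exact: Hf.
  suff H l T' : runs (While R isSome (move_top R (Lf j))) (st N e g (Mem T' none l [::]))
      (st N e g (Mem (upd T' j (rev l ++ T' j)) none [::] [::])) (8 * size l + 1).
    by rewrite cats0; have := H (rev (table N T e xs a)) T; rewrite revK size_rev size_table.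
  elim: l T' => [|b l IH] T'; first by rewrite /= upd_id; apply: runs_while_stop.
  apply: (@runs_le _ _ _ _ (6 + (8 * size l + 1) + 2)); last by rewrite /=; lia.
  apply: runs_while_go => //.
    exact: (@runs_move_cons _ _ b l).
  have := IH (upd T' j (b :: T' j)); rewrite upd_upd upd_same rev_cons cat_rcons.
  by rewrite st_R st_Lf.
- have [|f Pf Hf] := IHp; first by move=> y yv; apply: sub; rewrite mem_cat yv.
  have [|h Ph Hh] := IHq; first by move=> y yv; apply: sub; rewrite mem_cat yv orbT.
  exists (fun N => f N + h N) => [|N e g T He]; first by polyb_tac.
  by apply: runs_seq; [apply: Hf | apply: Hh].
- have [|f Pf Hf] := IH; first by move=> y yv; apply: sub; rewrite inE yv orbT.
  have xvs : x \in vs by apply: sub; rewrite inE eqxx.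
  exists (fun N => (f N + 20) * N + 6) => [|N e g T He]; first by polyb_tac.
  apply: (@runs_floop N e g (fun k => Mem (foldl (fun T i => psem N (upd e x i) p T) T (iota 0 k)) none [::] [::])) => // i g' iN.
  cbv beta; rewrite iota0S foldl_rcons.
  by apply: Hf; apply: env_upd => //; apply: ltnW.
Qed.

Hypothesis uniq_vs : uniq vs.

(** * Loading the input *)

Definition lengthen := foldr (fun x c => Push (U x) true ;; c) (Skip _) vs.

(** The word crosses the zipper only to be counted, and then goes back: every bit raises each [U x]
    by one, so all variables start with value 0 below the bound [N]. *)
Definition load :=
  While (Lf (0, 0)) isSome (move_top (Lf (0, 0)) (Rt (0, 0)) ;; lengthen) ;;
  While (Rt (0, 0)) isSome (move_top (Rt (0, 0)) (Lf (0, 0))).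

Definition env0 : env := fun=> 0.

Lemma runs_lengthen N g m :
  runs lengthen (st N env0 g m) (st N.+1 env0 g m) (size vs).
Proof.
have H qs s : uniq qs -> runs (foldr (fun x c => Push (U x) true ;; c) (Skip _) qs) s
    (fun r => if (r.1 == 1) && (r.2 \in qs) then true :: s r else s r) (size qs).
  elim: qs s => [|q qs IH] s /=.
    move=> _; rewrite [X in runs _ _ X _](_ : _ = s); first exact: runs_skip.
    by apply: functional_extensionality => r; rewrite andbF.
  case/andP=> Nq Uq; apply: (runs_seq (runs_push _ _ _)).
  rewrite [X in runs _ _ X _](_ : _ = fun r : regT => if (r.1 == 1) && (r.2 \in qs)
     then true :: upd s (U q) (true :: s (U q)) r else upd s (U q) (true :: s (U q)) r); first exact: IH.
  apply: functional_extensionality => -[a x] /=; rewrite /upd xpair_eqE inE.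
  by case: (a =P 1) => // ->; case: (x =P q) => [->|] //=; rewrite (negbTE Nq).
have := H vs (st N env0 g m) uniq_vs.
rewrite [X in runs _ _ X _ -> _](_ : _ = st N.+1 env0 g m) //.
apply: functional_extensionality => -[[|[|a]] x] //=.
by rewrite /st /= !subn0; case: (x \in vs).
Qed.

Lemma runs_load w : runs load (upd (fun=> [::]) (Lf (0, 0)) w)
  (st (size w) env0 [::] (Mem (upd none (0, 0) w) none [::] [::])) ((size vs + 16) * size w + 2).
Proof.
set j := (0, 0).
have -> : upd (fun=> [::]) (Lf j) w = st 0 env0 [::] (Mem (upd none j w) (upd none j [::]) [::] [::]).
  apply: functional_extensionality => -[[|[|[|[|[|[|[|a]]]]]]] x]; rewrite /upd /st /= ?xpair_eqE //=; by case: ifP.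
apply: (@runs_le _ _ _ _ (((size vs + 8) * size w + 1) + (8 * size (rev w) + 1))); last first.
  by rewrite size_rev; nia.
apply: (@runs_seq _ _ _ _ (st (size w) env0 [::] (Mem (upd none j [::]) (upd none j (rev w)) [::] [::]))); last first.
  by have := runs_rewind (size w) env0 [::] j [::] (rev w) none [::] [::]; rewrite revK cats0.
suff H l b N : runs (While (Lf j) isSome (move_top (Lf j) (Rt j) ;; lengthen))
    (st N env0 [::] (Mem (upd none j l) (upd none j b) [::] [::]))
    (st (N + size l) env0 [::] (Mem (upd none j [::]) (upd none j (rev l ++ b)) [::] [::]))
    ((size vs + 8) * size l + 1).
  by have := H w [::] 0; rewrite cats0.
elim: l b N => [|x l IH] b N.
  by rewrite addn0 muln0; apply: runs_while_stop; rewrite /st /= ?upd_same.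
apply: (@runs_le _ _ _ _ ((6 + size vs) + ((size vs + 8) * size l + 1) + 2)); last by rewrite /=; lia.
apply: (@runs_while_go _ _ _ _ _ (st N.+1 env0 [::] (Mem (upd none j l) (upd none j (x :: b)) [::] [::]))).
- by rewrite /st /= ?upd_same.
- apply: runs_seq (runs_lengthen _ _ _).
  have E : st N env0 [::] (Mem (upd none j (x :: l)) (upd none j b) [::] [::]) (Lf j) = x :: l.
    by rewrite /st /= ?upd_same.
  have := runs_move_cons (Rt j) E; rewrite st_Lf st_Rt /= !upd_upd.
  by rewrite {3}/st /= ?upd_same.
- by have := IH (x :: b) N.+1; rewrite rev_cons cat_rcons addSnnS.
Qed.

End Compiler.

Theorem program_machine p a :
  exists (Q : finType) (M : TM Q) (c d : nat), forall w : seq bool,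
    halts_with M w (c * (size w).+1 ^ d)
      (sem (size w) (psem (size w) env0 p (upd none (0, 0) w)) env0 a).
Proof.
pose vs := undup ((0, 0) :: pvars p ++ fvars a).
have v0 : (0, 0) \in vs by rewrite mem_undup inE eqxx.
have [|f Pf Hf] := runs_prog v0 (p := p).
  by move=> x xp; rewrite mem_undup inE mem_cat xp orbT.
have [|h Ph Hh] := runs_form v0 (a := a).
  by move=> x xp; rewrite mem_undup inE mem_cat xp !orbT.
have [Q [M [K HM]]] := while_machine (Lf (0, 0)) R (Seq (Seq (load vs) (cprog p)) (cform a)).
pose t n := (size vs + 16) * n + 2 + f n + h n.
have [||c [d Hcd]] := @polyb_mul (fun=> K) (fun n => (t n).+2 * (n + (t n).+2)).
- exact: polyb_const.
- have Pt : polyb (fun n => (t n).+2).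
    have : polyb (fun n => t n + 2) by polyb_tac.
    by case=> c [d H]; exists c, d => n; rewrite -addn2.
  by polyb_tac.
exists Q, M, c, d => w; set N := size w; set b := sem _ _ _ _.
have R0 := runs_seq (runs_seq (runs_load v0 (undup_uniq _) w) (Hf N env0 [::] (upd none (0, 0) w) (fun=> leq0n _)))
  (Hh N env0 [::] _ [::] (fun=> leq0n _)).
have := HM w _ _ (c * N.+1 ^ d) R0 (Hcd N).
by rewrite /st /= -/b; case: b.
Qed.

(** * The pebble game *)

Section Pebbles.
Variables (k : nat) (I : instance).
Hypotheses (wfI : well_formed I) (acI : acyclic I).
Let s := src I.
Let t := tgt I.

Definition reach u v := exists p, walk I u v p.

Lemma walk_cat u v w p q : walk I u w p -> walk I w v q -> walk I u v (p ++ q).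
Proof.
elim: p u => [|a p IH] u /=; first by move/eqP->.
by case/and3P=> -> -> /= /IH; apply.
Qed.

Lemma walk_split u v p q : walk I u v (p ++ q) -> exists2 w, walk I u w p & walk I w v q.
Proof.
elim: p u => [|a p IH] u /=; first by exists u => //; apply: eqxx.
by case/and3P=> -> -> /= /IH.
Qed.

Lemma walk_mem u v p a : walk I u v p -> a \in p ->
  exists p1 p2, [/\ p = p1 ++ a :: p2, walk I u (arc_tail I a) p1, walk I (arc_head I a) v p2
                 & a < size (arcs I)].
Proof.
move=> W ap; case/splitPr: ap W => p1 p2 W; exists p1, p2.
by case/walk_split: W => w W1 /= /and3P[la /eqP-> W2].
Qed.

Lemma reach_trans u v w : reach u v -> reach v w -> reach u w.
Proof. by case=> p Wp [q Wq]; exists (p ++ q); apply: walk_cat Wq. Qed.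

Lemma reach_anti u v : reach u v -> reach v u -> u = v.
Proof.
case=> p Wp [q Wq]; have := acI (walk_cat Wp Wq).
by case: p Wp => // /eqP.
Qed.

Lemma arc_bounded a : a < size (arcs I) -> arc_tail I a < nV I /\ arc_head I a < nV I.
Proof.
by case/and3P: wfI => _ _ /all_nthP-/(_ (0, 0)) H /H /andP[].
Qed.

(** A repeated vertex would cut out a closed walk. Hence walks can be used in place of paths
    throughout. *)
Lemma walk_uniq u v p : walk I u v p -> uniq (walk_vertices I u p).
Proof.
elim: p u => // a p IH u /and3P[la ta W].
apply/andP; split; last exact: IH W.
apply/negP => /(mapP (s := a :: p))[b bp Eu].
have [|p1 [p2 [_ W1 _ lb]]] := @walk_mem u v (a :: p) b _ bp; first by rewrite /= la ta.
have : walk I u u (p1 ++ [:: b]) by apply: walk_cat W1 _; rewrite /= lb -Eu !eqxx.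
by move/acI; case: (p1).
Qed.

Lemma walk_size u v p : walk I u v p -> size p <= nV I.
Proof.
move=> W; have /= /andP[_ U] := walk_uniq W.
rewrite -(size_map (arc_head I)) -[nV I](size_iota 0); apply: uniq_leq_size => // h /mapP[a ap ->].
rewrite mem_iota; have [_ [_ [_ _ _ /arc_bounded[]]]] := walk_mem W ap; lia.
Qed.

Lemma walk_path u v p : walk I u v p -> is_path I u v p.
Proof. by move=> W; rewrite /is_path W; apply: walk_uniq W. Qed.

Variables (N : nat) (code : nat -> nat).
Hypotheses (nV_N : nV I < N)
  (code_inj : forall a b, a < size (arcs I) -> b < size (arcs I) -> code a = code b -> a = b)
  (code_N : forall a, a < size (arcs I) -> code a < N).

Definition coded_arc c u v :=
  exists a, [/\ a < size (arcs I), c = code a, arc_tail I a = u & arc_head I a = v].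

(* [x i] is the vertex of pebble [i]; all pebbles at a vertex [u] that no other
   pebble can reach move at once.  Pebbles [i < j] may only share the arc
   coded by [e i j], and not an arc from [s] to [t], as this would force
   their paths to be equal. *)
Definition pebble_move (e : nat -> nat -> nat) (x y : nat -> nat) :=
  exists u (a : nat -> nat), [/\ u < N /\ (forall i, i < k -> a i < N),
    u <> t, exists2 i, i < k & x i = u,
    forall i, i < k -> [/\ x i <> u, x i = t \/ ~ reach (x i) u & y i = x i] \/
                       x i = u /\ coded_arc (a i) u (y i) &
    forall i j, i < j < k -> x i = u -> x j = u -> a i = a j ->
      e i j = a i /\ ~ (u = s /\ y i = t)].

(** Stage [m] of the least fixed point: the game is won in fewer than [m] moves. *)
Fixpoint win m (e : nat -> nat -> nat) (x : nat -> nat) : Prop :=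
  if m is m'.+1 then
    (forall i, i < k -> x i = t) \/
    exists2 y, (forall i, i < k -> y i < N) & pebble_move e x y /\ win m' e y
  else False.

Definition sharing (e : nat -> nat -> nat) (P : nat -> seq nat) :=
  forall i j b, i < j < k -> b \in P i -> b \in P j ->
    e i j = code b /\ ~ (arc_tail I b = s /\ arc_head I b = t).

(** The arcs of the present round are put in front of the paths given by induction. A shared arc is
    then crossed by both pebbles now, where the move condition applies, or by both later, where
    induction applies; the mixed cases are excluded by [old]. *)
Lemma win_paths m e x : win m e x ->
  exists2 P, forall i, i < k -> walk I (x i) t (P i) & sharing e P.
Proof.
elim: m x => //= m IH x [Ht|[y yN [[u [a [_ ut _ Hm He]]]]]].
  by exists (fun=> [::]) => // i /Ht ->; rewrite /= eqxx.
case/IH=> P' W' S'.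
pose arc_of c := index c (mkseq code (size (arcs I))).
have arc_ofK c v : coded_arc c u v ->
    [/\ arc_of c < size (arcs I), c = code (arc_of c), arc_tail I (arc_of c) = u & arc_head I (arc_of c) = v].
  case=> b [lb Ec tb hb]; suff -> : arc_of c = b by [].
  have cin : c \in mkseq code (size (arcs I)) by apply/mapP; exists b; rewrite ?mem_iota.
  have lt : arc_of c < size (arcs I) by rewrite -[size (arcs I)](size_mkseq code) index_mem.
  by apply: code_inj => //; rewrite -Ec -[LHS](nth_mkseq 0 code lt) nth_index.
exists (fun i => if x i == u then arc_of (a i) :: P' i else P' i) => [i ik|].
  case: eqP => xu; last by case: (Hm i ik) => [[_ _ <-]|[]//]; apply: W'.
  case: (Hm i ik) => [[]//|[_ /arc_ofK[la _ ta ha]]].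
  by rewrite /= la ta xu eqxx ha W'.
(* No later path contains an arc leaving [u]: a pebble that has just left [u] cannot return by
   acyclicity, and any other pebble either stands at [t], so that its walk is empty, or cannot reach
   [u]. *)
have old i b : i < k -> b \in P' i -> arc_tail I b = u -> [/\ x i = u -> False & x i <> u -> False].
  move=> ik bP tb; have [p1 [p2 [_ W1 W2 lb]]] := walk_mem (W' i ik) bP.
  rewrite tb in W1; split=> xu; case: (Hm i ik) => [[xu' Hr Ey]|[xu' Ha]] //.
    have [la _ ta ha] := arc_ofK _ _ Ha.
    have /acI // : walk I u u (arc_of (a i) :: p1) by rewrite /= la ta eqxx ha.
  rewrite Ey in W1; case: Hr => [xt|]; last by apply; exists p1.
  by have := W' i ik; rewrite Ey xt => /acI E; rewrite E in bP.
move=> i j b /andP[ij jk]; have ik := ltn_trans ij jk.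
case: (x i =P u) => xi; case: (x j =P u) => xj; rewrite ?inE.
- case: (Hm i ik) => [[]//|[_ /arc_ofK[lai Eai tai hai]]].
  case: (Hm j jk) => [[]//|[_ /arc_ofK[laj Eaj taj haj]]].
  case/predU1P=> [->|bi] /predU1P[E|bj].
  + rewrite tai hai -Eai; apply: He; rewrite ?ij //.
    by rewrite Eai E -Eaj.
  + by have [] := old j _ jk bj tai.
  + by rewrite E in bi; have [] := old i _ ik bi taj.
  + by apply: S'; rewrite ?ij.
- case: (Hm i ik) => [[]//|[_ /arc_ofK[lai Eai tai hai]]].
  case/predU1P=> [->|bi] bj; last by apply: S'; rewrite ?ij.
  by have [] := old j _ jk bj tai.
- case: (Hm j jk) => [[]//|[_ /arc_ofK[laj Eaj taj haj]]].
  move=> bi /predU1P[E|bj]; last by apply: S'; rewrite ?ij.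
  by rewrite E in bi; have [] := old i _ ik bi taj.
- by move=> bi bj; apply: S'; rewrite ?ij.
Qed.

Lemma win_ext m e e' x x' : (forall i, i < k -> x i = x' i) ->
  (forall i j, i < k -> j < k -> e i j = e' i j) -> win m e x -> win m e' x'.
Proof.
elim: m x x' => //= m IH x x' Ex Ee [Ht|[y yN [[u [a [Ha ut [i0 i0k xi0] Hm He]]] Hw]]].
  by left=> i ik; rewrite -Ex ?Ht.
right; exists y => //; split; last exact: IH Hw.
exists u, a; split=> //.
- by exists i0; rewrite -?Ex.
- by move=> i ik; rewrite -Ex //; apply: Hm.
- move=> i j ijk; have /andP[ij jk] := ijk; have ik := ltn_trans ij jk.
  by rewrite -!Ex // -Ee //; apply: He.
Qed.

(** By [reach_anti] reachability is a partial order, so finitely many positions have a minimal one.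
    As [reach] is a bare [Prop], the case distinction is classical. *)
Lemma exists_source (x : nat -> nat) l : l != [::] ->
  exists2 i, i \in l & forall j, j \in l -> x j <> x i -> ~ reach (x j) (x i).
Proof.
elim: l => // i1 l IH _; case: (eqVneq l [::]) => [->|/IH[i0 il Hi]].
  by exists i1; rewrite ?inE // => j; rewrite inE => /eqP->.
case: (classic (x i1 <> x i0 /\ reach (x i1) (x i0))) => [[ne r10]|nr].
  exists i1; first by rewrite inE eqxx.
  move=> j; rewrite inE => /predU1P[->//|jl] nej rj1.
  have rj0 := reach_trans rj1 r10.
  case: (x j =P x i0) => [Ej|/(Hi j jl)//].
  by rewrite Ej in rj1; apply: ne; apply: reach_anti.
exists i0; first by rewrite inE il orbT.
move=> j; rewrite inE => /predU1P[->|/Hi//] ne r; exact: nr.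
Qed.

(** The pebbles follow the given paths, always moving from a source among the positions of
    unfinished pebbles; each round removes at least one arc from the remaining paths. *)
Lemma paths_win m e x P : (forall i, i < k -> x i < N) -> (forall i, i < k -> walk I (x i) t (P i)) ->
  sharing e P -> \sum_(i < k) size (P i) < m -> win m e x.
Proof.
elim: m x P => // m IH x P xN W S Hsum /=.
(* Only unfinished pebbles compete for the source. A pebble with empty remaining path is at [t],
   where the move condition does not ask for reachability. *)
pose l := [seq i <- iota 0 k | P i != [::]].
have lE i : (i \in l) = (P i != [::]) && (i < k) by rewrite mem_filter mem_iota.
case: (eqVneq l [::]) => [l0|/(exists_source x)[i0 i0l Hsrc]].
  left=> i ik; have := lE i; rewrite l0 ik andbT in_nil => /esym/negbFE/eqP Pi.
  by have := W i ik; rewrite Pi => /eqP.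
right; pose u := x i0; have [/negP Pi0 i0k] : P i0 != [::] /\ i0 < k by apply/andP; rewrite -lE.
have ut : u <> t by move=> ut; have := W i0 i0k; rewrite -/u ut => /acI E; rewrite E in Pi0.
have Pcons i : i < k -> x i = u -> exists b p, [/\ P i = b :: p, b < size (arcs I), arc_tail I b = u & walk I (arc_head I b) t p].
  move=> ik xi; have := W i ik; rewrite xi; case: (P i) => [/eqP//|b p /= /and3P[lb /eqP tb Wp]].
  by exists b, p.
pose y i := if (x i == u) && (i < k) then arc_head I (head 0 (P i)) else x i.
pose P' i := if (x i == u) && (i < k) then behead (P i) else P i.
pose a i := if (x i == u) && (i < k) then code (head 0 (P i)) else 0.
have N0 : 0 < N by apply: leq_ltn_trans nV_N.
exists y => [i ik|].
  rewrite /y ik andbT; case: eqP => [xi|_]; last exact: xN.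
  have [b [p [-> lb _ _]]] := Pcons i ik xi; rewrite /=; have := (arc_bounded lb).2; lia.
split.
  exists u, a; split => //.
  - split=> [|i ik]; first exact: xN.
    rewrite /a ik andbT; case: eqP => // xi.
    by have [b [p [-> lb _ _]]] := Pcons i ik xi; apply: code_N.
  - by exists i0.
  - move=> i ik; rewrite /y /a ik andbT; case: eqP => xi; [right|left]; last first.
      split=> //; case: (eqVneq (P i) [::]) => [Pi|Pi].
        by left; have := W i ik; rewrite Pi => /eqP.
      by right; apply: Hsrc => //; rewrite lE Pi ik.
    split=> //; have [b [p [-> lb tb _]]] := Pcons i ik xi.
    by exists b.
  - move=> i j /andP[ij jk] xi xj; have ik := ltn_trans ij jk.
    rewrite /a /y ik jk xi xj eqxx /=.
    have [b [p [Ei lb tb _]]] := Pcons i ik xi.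
    have [b' [p' [Ej lb' tb' _]]] := Pcons j jk xj.
    rewrite Ei Ej /= => /code_inj -/(_ lb lb') Eb; rewrite -tb.
    by apply: (S i j); rewrite ?ij ?Ei ?Ej ?Eb ?inE ?eqxx.
apply: (IH y P').
- move=> i ik; rewrite /y ik andbT; case: eqP => [xi|_]; last exact: xN.
  have [b [p [-> lb _ _]]] := Pcons i ik xi; rewrite /=; have := (arc_bounded lb).2; lia.
- move=> i ik; rewrite /y /P' ik andbT; case: eqP => xi; last exact: W.
  by have [b [p [-> lb _ Wp]]] := Pcons i ik xi.
- have sub i : {subset P' i <= P i} by move=> b; rewrite /P'; case: ifP => // _ /mem_behead.
  by move=> i j b ijk bi bj; apply: S => //; apply: sub.
- rewrite -ltnS; apply: leq_trans Hsum.
  rewrite (bigD1 (Ordinal i0k)) //= [in leqRHS](bigD1 (Ordinal i0k)) //=.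
  rewrite /P' i0k eqxx /=; have [b [p [-> _ _ _]]] := Pcons i0 i0k erefl.
  rewrite /= !addSn !ltnS leq_add2l; apply: leq_sum => i _.
  by case: ifP => // _; rewrite size_behead leq_pred.
Qed.

(** If [s = t], the empty path is the only one by acyclicity, so [k <= 1] is forced; for [k <= 1] no
    two paths have to be distinguished. *)
Lemma ADP_win : ADP k I <->
  (k <= 1 \/ s <> t) /\
  exists2 e : nat -> nat -> nat, (forall i j, e i j < N) & win (N ^ k.+1) e (fun=> s).
Proof.
have N0 : 0 < N by apply: leq_ltn_trans nV_N.
have [sV tV] : s < nV I /\ t < nV I by case/and3P: wfI.
split=> [[P [HP injP disP]]|[kst [e eN /win_paths[P W S]]]].
  pose P' i := if insub i is Some o then P o else [::].
  have P'E (o : 'I_k) : P' o = P o by rewrite /P' valK.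
  have W i : i < k -> walk I s t (P' i).
    by move=> ik; rewrite (P'E (Ordinal ik)); case/andP: (HP (Ordinal ik)).
  split.
    case: (leqP k 1) => k1; [by left|right=> st].
    have k0 : 0 < k by apply: ltnW.
    have := W 0 k0; have := W 1 k1; rewrite st => /acI E1 /acI E0.
    have E : P (Ordinal k0) = P (Ordinal k1) by rewrite -!P'E /= E0 E1.
    by have := congr1 val (injP _ _ E).
  (* The guess is the first common arc, which is the only one by almost disjointness. The inner test
     and the default 0 give the bound [N] for all [i] and [j], also beyond [k]. *)
  pose e i j := if [seq b <- P' i | b \in P' j] is b :: _ then
     if b < size (arcs I) then code b else 0 else 0.
  exists e.
    move=> i j; rewrite /e; case: filter => // b _; case: ifP => // lb; exact: code_N.
  apply: (paths_win (P := P')) => //.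
  - by move=> _ _; apply: ltn_trans nV_N.
  - move=> i j b /andP[ij jk] bi bj; have ik := ltn_trans ij jk.
    have [p1 [p2 [Ei W1 W2 lb]]] := walk_mem (W i ik) bi.
    have [q1 [q2 [Ej V1 V2 _]]] := walk_mem (W j jk) bj.
    have nij : Ordinal ik != Ordinal jk by rewrite -val_eqE /= neq_ltn ij.
    split; last first.
      case=> tb hb; rewrite tb in W1 V1; rewrite hb in W2 V2.
      case/eqP: nij; apply: injP; rewrite -!P'E /= Ei Ej.
      by rewrite (acI W1) (acI W2) (acI V1) (acI V2).
    have : b \in [seq b <- P' i | b \in P' j] by rewrite mem_filter bj bi.
    rewrite /e; case E: filter => [//|c l] _.
    have : c \in [seq b <- P' i | b \in P' j] by rewrite E inE eqxx.
    rewrite mem_filter => /andP[cj ci].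
    rewrite (_ : c = b) ?lb //.
    by apply: (disP _ _ nij); rewrite -P'E.
  (* Each path has at most [nV I] arcs, and [k * N < N ^ k * N] because [N] is at least 2. *)
  - apply: (@leq_ltn_trans (\sum_(i < k) N)).
      by apply: leq_sum => i _; apply: leq_trans (walk_size (W i (ltn_ord i))) (ltnW nV_N).
    rewrite sum_nat_const card_ord expnSr ltn_pmul2r //; apply: ltn_expl; lia.
have adj (i j : 'I_k) : i != j -> P i != P j /\ almost_disjoint (P i) (P j).
  wlog ij : i j / i < j => [H nij|_].
    case: (ltngtP i j) => [ij|ij|/val_inj E]; first exact: H.
      have [|N1 D] := H _ _ ij; first by rewrite eq_sym.
      by split; [rewrite eq_sym | move=> a b ai aj bi bj; apply: D].
    by rewrite E eqxx in nij.
  have ijk : i < j < k by rewrite ij ltn_ord.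
  have lb b : b \in P i -> b < size (arcs I).
    by move=> bi; have [_ [_ [_ _ _]]] := walk_mem (W i (ltn_ord i)) bi.
  have one a b : a \in P i -> a \in P j -> b \in P i -> b \in P j -> a = b.
    move=> ai aj bi bj; apply: code_inj; rewrite ?lb //.
    by rewrite -(S i j a ijk ai aj).1 -(S i j b ijk bi bj).1.
  split=> //; apply/eqP => E.
  (* Equal paths share all their arcs. With two or more arcs, the first two would be the same arc,
     whose head is then its tail: a cycle. *)
  case EP: (P i) (W i (ltn_ord i)) => [|b [|b' p]] /=.
  - by move/eqP; case: kst => // k1; have := ltn_ord j; lia.
  - case/and3P=> _ /eqP tb /eqP hb.
    by have [||_ []] := S i j b ijk; rewrite -?E ?EP ?inE.
  - case/and3P=> Lb /eqP tb /and3P[_ tb' _].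
    have Eb : b' = b by apply: one; rewrite -?E EP !inE eqxx ?orbT.
    have /acI // : walk I (arc_tail I b) (arc_tail I b) [:: b].
    by rewrite /= Lb eqxx /= -(eqP tb') Eb.
exists (fun i : 'I_k => P i); split.
- by move=> i; apply: walk_path; apply: W.
- move=> i j E; apply/eqP/negP => /negP/adj[/eqP]; by rewrite E.
- by move=> i j /adj[].
Qed.

End Pebbles.

(** * Relations defined in stages *)

Arguments sem : simpl never.

Definition rel_of N (T : tables) j (ys : seq nat) : bool := nth false (T j) (index_of N ys).

Lemma index_of_lt N ys : all (fun y => y < N) ys -> index_of N ys < N ^ size ys.
Proof.
elim: ys => //= y ys IH /andP[yN /IH lt]; rewrite expnS.
apply: (@leq_trans (y.+1 * N ^ size ys)); last by rewrite leq_mul2r yN orbT.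
by rewrite mulSn addnC ltn_add2r.
Qed.

Lemma nth_flatten_blocks (f : nat -> seq bool) b m n y i (old : seq bool) :
  (forall j, size (f j) = b) -> m <= y < m + n -> i < b ->
  nth false (flatten [seq f j | j <- iota m n] ++ old) ((y - m) * b + i) = nth false (f y) i.
Proof.
move=> Hb; elim: n m => [|n IH] m; first by lia.
move=> /andP[my ymn] ib /=; rewrite -catA nth_cat Hb.
case: (ltngtP m y) my => // [my _|<- _]; last by rewrite subnn mul0n add0n ib.
have -> : y - m = (y - m.+1).+1 by lia.
rewrite mulSn -addnA ltnNge leq_addr /= addKn IH //; lia.
Qed.

Fixpoint updl (e : env) xs ys : env :=
  match xs, ys with
  | x :: xs', y :: ys' => updl (upd e x y) xs' ys'
  | _, _ => e
  end.

Lemma updl_notin e xs ys x : x \notin xs -> updl e xs ys x = e x.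
Proof.
elim: xs ys e => [|z xs IH] [|y ys] e //=; rewrite inE negb_or => /andP[xz xxs].
by rewrite IH // /upd (negbTE xz).
Qed.

Lemma map_updl e xs ys : uniq xs -> size ys = size xs -> map (updl e xs ys) xs = ys.
Proof.
elim: xs ys e => [|x xs IH] [|y ys] e //= /andP[nx ux] [E].
by rewrite updl_notin // /upd eqxx IH.
Qed.

Lemma nth_table N T e xs a ys old : size ys = size xs -> all (fun y => y < N) ys ->
  nth false (table N T e xs a ++ old) (index_of N ys) = sem N T (updl e xs ys) a.
Proof.
elim: xs ys e old => [|x xs IH] [|y ys] e old //= [E] /andP[yN ysN].
rewrite -[y in y * _](subn0 y) (@nth_flatten_blocks _ (N ^ size ys)) //.
- by have := IH ys (upd e x y) [::] E ysN; rewrite cats0.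
- by move=> i; rewrite size_table E.
- exact: index_of_lt.
Qed.

(* The loops only count, hence the claim for every environment [e]. *)
Lemma psem_stages j xs a N T0 (P : nat -> seq nat -> Prop) : uniq xs -> T0 j = [::] ->
  (forall ys, ~ P 0 ys) ->
  (forall m T e, (forall i, i != j -> T i = T0 i) ->
     (forall ys, size ys = size xs -> all (fun y => y < N) ys -> rel_of N T j ys <-> P m ys) ->
     all (fun x => e x < N) xs -> sem N T e a <-> P m.+1 (map e xs)) ->
  forall c e, let T := psem N e (iter c (For (9, 9)) (Tab j xs a)) T0 in
    (forall i, i != j -> T i = T0 i) /\
    (forall ys, size ys = size xs -> all (fun y => y < N) ys -> rel_of N T j ys <-> P (N ^ c) ys).
Proof.
move=> Uxs T0j P0 Pstep c e.
(* The run may start at any stage [m], so that the stages of consecutive rounds of a loop add up,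
   and those of nested loops multiply. *)
pose Inv m T := (forall i, i != j -> T i = T0 i) /\
    (forall ys, size ys = size xs -> all (fun y => y < N) ys -> rel_of N T j ys <-> P m ys).
suff H m T : Inv m T -> Inv (m + N ^ c) (psem N e (iter c (For (9, 9)) (Tab j xs a)) T).
  apply: (H 0); split => // ys _ _; rewrite /rel_of T0j nth_nil; by split=> // /P0.
elim: c e m T => [|c IH] e m T; last first.
  suff K l m' T' : Inv m' T' -> Inv (m' + size l * N ^ c)
      (foldl (fun T i => psem N (upd e (9, 9) i) (iter c (For (9, 9)) (Tab j xs a)) T) T' l).
    by move=> /(K (iota 0 N) m T); rewrite size_iota expnS.
  elim: l m' T' => [|i l IHl] m' T' InvT; first by rewrite addn0.
  by rewrite /= mulSn addnA; apply: IHl; apply: IH.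
case=> H1 H2; split=> [i ij|ys Es Ha] /=; first by rewrite upd_other ?H1.
rewrite /rel_of upd_same nth_table // addn1.
have Em := map_updl e Uxs Es; rewrite -[in X in _ <-> X]Em.
apply: (Pstep m T) => //; rewrite -(all_map _ (fun y => y < N)) Em //.
Qed.

Lemma sem_And N T e a b : sem N T e (And a b) = sem N T e a && sem N T e b.
Proof. by []. Qed.

Lemma sem_Not N T e a : sem N T e (Not a) = ~~ sem N T e a.
Proof. by []. Qed.

Lemma sem_Rel N T e j xs : sem N T e (Rel j xs) = rel_of N T j (map e xs).
Proof. by []. Qed.

Lemma sem_Le N T e c xs y : sem N T e (Le c xs y) = (c + sumn (map e xs) <= e y).
Proof. by []. Qed.

Lemma sem_ExP N T e x a : reflect (exists2 i, i < N & sem N T (upd e x i) a) (sem N T e (Ex x a)).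
Proof.
apply: (iffP hasP) => -[i]; rewrite ?mem_iota => iN H; exists i => //.
by rewrite mem_iota.
Qed.

(** * Derived connectives *)

Definition Or a b := Not (And (Not a) (Not b)).

Lemma sem_Or N T e a b : sem N T e (Or a b) = sem N T e a || sem N T e b.
Proof. by rewrite /Or sem_Not sem_And !sem_Not negb_and !negbK. Qed.

Definition Sum c xs y := And (Le c xs y) (Not (Le c.+1 xs y)).

Lemma sem_Sum N T e c xs y : sem N T e (Sum c xs y) = (e y == c + sumn (map e xs)).
Proof. by rewrite /Sum sem_And sem_Not !sem_Le; lia. Qed.

Definition Eq x y := Sum 0 [:: x] y.

Lemma sem_Eq N T e x y : sem N T e (Eq x y) = (e x == e y).
Proof. by rewrite sem_Sum /= addn0 add0n eq_sym. Qed.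

Definition All k (F : nat -> form) := foldr (fun i => And (F i)) (Le 0 [::] (0, 0)) (iota 0 k).

Lemma sem_All N T e k F : sem N T e (All k F) = all (fun i => sem N T e (F i)) (iota 0 k).
Proof. by rewrite /All; elim: (iota 0 k) => //= i l IH; rewrite sem_And IH. Qed.

Lemma sem_AllP N T e k F : reflect (forall i, i < k -> sem N T e (F i)) (sem N T e (All k F)).
Proof.
rewrite sem_All; apply: (iffP allP) => H i; last by rewrite mem_iota => ik; apply: H.
by move=> ik; apply: H; rewrite mem_iota.
Qed.

Definition Any k (F : nat -> form) := Not (All k (fun i => Not (F i))).

Lemma sem_AnyP N T e k F : reflect (exists2 i, i < k & sem N T e (F i)) (sem N T e (Any k F)).
Proof.
rewrite /Any sem_Not sem_All -has_predC; apply: (iffP hasP) => -[i].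
  by rewrite mem_iota /= sem_Not negbK => ik H; exists i.
by move=> ik H; exists i; rewrite ?mem_iota //= sem_Not negbK.
Qed.

Definition ExAll := foldr Ex.

Lemma sem_ExAllP N T e xs a :
  reflect (exists e', [/\ forall x, x \notin xs -> e' x = e x, forall x, x \in xs -> e' x < N & sem N T e' a])
    (sem N T e (ExAll a xs)).
Proof.
elim: xs e => [|x xs IH] e /=.
  apply: (iffP idP) => [H|[e' [E _ H]]]; first by exists e.
  by rewrite (_ : e = e') //; apply: functional_extensionality => x; rewrite E.
apply: (iffP (sem_ExP _ _ _ _ _)) => [[i iN /IH[e' [E1 E2 H]]]|[e' [E1 E2 H]]].
  exists e'; split=> // z; first by rewrite inE negb_or => /andP[zx /E1->]; rewrite upd_other.
  rewrite inE; case: (boolP (z \in xs)) => [/E2//|zxs]; rewrite orbF => /eqP zx.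
  by rewrite (E1 _ zxs) zx upd_same.
exists (e' x); first by apply: E2; rewrite inE eqxx.
apply/IH; exists e'; split=> // z zxs; last by apply: E2; rewrite inE zxs orbT.
by rewrite /upd; case: eqP => [->//|/eqP zx]; apply: E1; rewrite inE negb_or zx.
Qed.

(** * Parsing the input *)

Definition tWord : ident := (0, 0).
Definition tItem : ident := (1, 0).
Definition tReach : ident := (2, 0).
Definition tWin : ident := (3, 0).

Lemma upd_class (e : env) v x i : x.1 != v.1 -> upd e v i x = e x.
Proof. by move=> ne; apply: upd_other; apply: contraNneq ne => ->. Qed.

Definition Bit x := Rel tWord [:: x].
Definition Zero x := Not (Le 1 [::] x).

(* Quantified names are separated by their first component: 9 in [NatF], 8 in
   [HeaderF] and [CellF], 7 in [SrcF], [TgtF] and [ArcF], and 6 or less in the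
   formulas that are tabulated. *)
Definition NatF p x q :=
  And (Sum 1 [:: p; x] q)
    (Ex (9, 0) (And (Sum 0 [:: p; x] (9, 0)) (And (Not (Bit (9, 0)))
      (Not (Ex (9, 1) (And (Le 0 [:: p] (9, 1)) (And (Le 1 [:: (9, 1)] (9, 0)) (Not (Bit (9, 1)))))))))).

Definition HeaderF n s t p :=
  Ex (8, 0) (Ex (8, 1) (Ex (8, 2)
    (And (Zero (8, 0)) (And (NatF (8, 0) n (8, 1)) (And (NatF (8, 1) s (8, 2)) (NatF (8, 2) t p)))))).

Definition CellF p u v q :=
  And (Bit p) (Ex (8, 0) (Ex (8, 1) (And (Sum 1 [:: p] (8, 0)) (And (NatF (8, 0) u (8, 1)) (NatF (8, 1) v q))))).

Definition SrcF s := Ex (7, 0) (Ex (7, 1) (Ex (7, 2) (HeaderF (7, 0) s (7, 1) (7, 2)))).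
Definition TgtF t := Ex (7, 0) (Ex (7, 1) (Ex (7, 2) (HeaderF (7, 0) (7, 1) t (7, 2)))).
(** The test by [tItem] excludes positions inside a unary number, from which bits could also be
    parsed as an arc. *)
Definition ArcF c u v := And (Rel tItem [:: c]) (Ex (7, 0) (CellF c u v (7, 0))).

(** An entry of the list starts right after the header or right after an arc that itself starts at
    an entry; the position of the closing mark is included. *)
Definition ItemF p :=
  Or (Ex (6, 0) (Ex (6, 1) (Ex (6, 2) (HeaderF (6, 0) (6, 1) (6, 2) p))))
     (Ex (6, 0) (Ex (6, 1) (Ex (6, 2) (And (Rel tItem [:: (6, 0)]) (CellF (6, 0) (6, 1) (6, 2) p))))).

Definition ReachF u v :=
  Or (Eq u v) (Ex (6, 0) (Ex (6, 1) (And (ArcF (6, 0) u (6, 1)) (Rel tReach [:: (6, 1); v])))).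

Lemma size_enc_nat n : size (enc_nat n) = n.+1.
Proof. by rewrite size_cat size_nseq addn1. Qed.

Lemma enc_nat_inj x y r r' : enc_nat x ++ r = enc_nat y ++ r' -> x = y.
Proof. by elim: x y => [|x IH] [|y] //= [/IH->]. Qed.

Definition nat_at (w : seq bool) p x := exists r, drop p w = enc_nat x ++ r.

Lemma nat_at_eq w p x r y : drop p w = enc_nat x ++ r -> nat_at w p y -> y = x.
Proof. by move=> E [r' E']; apply: (@enc_nat_inj _ _ r' r); rewrite -E. Qed.

Lemma nat_at_next w p x r : drop p w = enc_nat x ++ r -> drop (p + x).+1 w = r.
Proof.
move=> E; rewrite -addnS addnC -drop_drop E drop_size_cat //; exact: size_enc_nat.
Qed.

(** A description by single bits, which a first-order formula can state. *)
Lemma nat_atP w p x : nat_at w p x <->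
  [/\ p + x < size w, ~~ nth false w (p + x) & forall z, p <= z < p + x -> nth false w z].
Proof.
split=> [[r E]|].
  have Ez z : nth false w (p + z) = nth false (enc_nat x ++ r) z by rewrite -nth_drop E.
  split.
  - have := congr1 size E; rewrite size_drop size_cat size_enc_nat; lia.
  - by rewrite Ez nth_cat size_enc_nat ltnSn nth_cat size_nseq ltnn subnn.
  - move=> z /andP[pz zx]; rewrite -(subnKC pz) Ez nth_cat size_enc_nat.
    have zp : z - p < x by lia.
    by rewrite (leqW zp) nth_cat size_nseq zp nth_nseq zp.
elim: x p => [|x IH] p [lt Nb Hb].
  rewrite addn0 in lt Nb; exists (drop p.+1 w).
  by rewrite (drop_nth false lt) (negbTE Nb).
have [|r E] := IH p.+1.
  by rewrite addSnnS; split=> // z /andP[pz zx]; apply: Hb; lia.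
exists r; rewrite (drop_nth false) ?E; last by lia.
by rewrite Hb //; lia.
Qed.

Lemma sem_Zero N T e x : sem N T e (Zero x) = (e x == 0).
Proof. by rewrite sem_Not sem_Le /=; case: (e x). Qed.

Section Words.
Variables (w : seq bool) (T : tables).
Hypothesis Tw : T tWord = w.
Let N := size w.

Lemma sem_Bit e x : sem N T e (Bit x) = nth false w (e x).
Proof. by rewrite sem_Rel /rel_of Tw /= muln1 addn0. Qed.

Definition semE := (sem_Eq, sem_Sum, sem_Zero, sem_Bit, sem_Or, sem_And, sem_Not, sem_Le).

Lemma sem_NatF e p x q : p.1 != 9 -> x.1 != 9 -> e q < N ->
  sem N T e (NatF p x q) <-> nat_at w (e p) (e x) /\ e q = (e p + e x).+1.
Proof.
move=> p9 x9 qN; rewrite /NatF sem_And sem_Sum nat_atP /= addn0 add1n.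
have Ep i j : upd (upd e (9, 0) i) (9, 1) j p = e p by rewrite !upd_class.
have Ep' i : upd e (9, 0) i p = e p by rewrite !upd_class.
have Ex' i : upd e (9, 0) i x = e x by rewrite !upd_class.
split.
  case/andP=> /eqP Eq /sem_ExP[i iN]; rewrite !semE /= Ep' Ex' addn0 add0n {1 3}/upd /=.
  case/and3P=> /eqP-> Nb /sem_ExP H; split=> //; split=> //; first by lia.
  move=> z /andP[pz zi]; apply/idPn => Nz; apply: H; exists z; first by lia.
  by rewrite !semE /= Ep /upd /= Nz; lia.
case=> -[lt Nb Hb] Eq; rewrite Eq eqxx /=; apply/sem_ExP; exists (e p + e x) => //.
rewrite !semE /= Ep' Ex' addn0 add0n {1 2 3}/upd /= eqxx Nb /=.
apply/sem_ExP => -[z zN]; rewrite !semE /= Ep /upd /= => /and3P[pz zi /negP[]]; apply: Hb; lia.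
Qed.
End Words.

(** * The encoding of an instance *)

Section Instance.
Variable I : instance.
Let w := encode I.
Let N := size w.

(** Measured from the end of the word, where the encoding of the remaining arcs is a suffix; for
    [i = size (arcs I)] this is the closing mark. *)
Definition item_pos i := size (encode I) - size (enc_arcs (drop i (arcs I))).

Lemma encode_suffix i : exists u, w = u ++ enc_arcs (drop i (arcs I)).
Proof.
suff [u E] : exists u, enc_arcs (arcs I) = u ++ enc_arcs (drop i (arcs I)).
  by exists (enc_nat (nV I) ++ enc_nat (src I) ++ enc_nat (tgt I) ++ u); rewrite /w /encode E -!catA.
elim: (arcs I) i => [|a l IH] [|i] /=; try by exists [::].
have [u ->] := IH i; by exists (true :: enc_nat a.1 ++ enc_nat a.2 ++ u); rewrite /= -!catA.
Qed.

Lemma drop_item i : drop (item_pos i) w = enc_arcs (drop i (arcs I)).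
Proof.
have [u E] := encode_suffix i.
have Es : size w = size u + size (enc_arcs (drop i (arcs I))) by rewrite E size_cat.
by rewrite /item_pos -/w Es addnK E drop_size_cat.
Qed.

Lemma item_posE i : item_pos i + size (enc_arcs (drop i (arcs I))) = N.
Proof. by have [u E] := encode_suffix i; rewrite /item_pos subnK // -/w E size_cat leq_addl. Qed.

Lemma size_enc_arcs_gt0 l : 0 < size (enc_arcs l).
Proof. by case: l. Qed.

Lemma item_pos_lt i : item_pos i < N.
Proof. have := item_posE i; have := size_enc_arcs_gt0 (drop i (arcs I)); lia. Qed.

Lemma enc_arcs_drop i : i < size (arcs I) ->
  enc_arcs (drop i (arcs I)) = true :: enc_nat (arc_tail I i) ++ enc_nat (arc_head I i) ++ enc_arcs (drop i.+1 (arcs I)).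
Proof. by move=> lt; rewrite (drop_nth (0, 0) lt). Qed.

Lemma item_posS i : i < size (arcs I) -> item_pos i.+1 = (item_pos i + (arc_tail I i + arc_head I i)).+3.
Proof.
move=> lt; have := item_posE i; have := item_posE i.+1.
rewrite (enc_arcs_drop lt) -cat1s !(size_enc_nat, size_cat) /=; lia.
Qed.

Lemma item_pos_inj i j : i < size (arcs I) -> j < size (arcs I) -> item_pos i = item_pos j -> i = j.
Proof.
have mono a b : a < b -> b <= size (arcs I) -> item_pos a < item_pos b.
  elim: b => // b IH; rewrite ltnS leq_eqVlt => /predU1P[->|ab] bs; rewrite (item_posS bs); first by lia.
  by have := IH ab (ltnW bs); lia.
move=> li lj E; case: (ltngtP i j) => // ij.
- by have := mono _ _ ij (ltnW lj); rewrite E ltnn.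
- by have := mono _ _ ij (ltnW li); rewrite E ltnn.
Qed.

Lemma size_encode : N = nV I + src I + tgt I + 3 + size (enc_arcs (arcs I)).
Proof. by rewrite /N /w /encode !(size_enc_nat, size_cat); lia. Qed.

Lemma size_enc_arcs l : size l < size (enc_arcs l).
Proof. by elim: l => //= a l IH; rewrite !size_cat; lia. Qed.

Lemma item_pos0 : item_pos 0 = nV I + src I + tgt I + 3.
Proof. have := item_posE 0; have := size_encode; rewrite drop0; lia. Qed.

Lemma nV_lt : nV I < N.
Proof. by rewrite size_encode; lia. Qed.

Variable T : tables.
Hypotheses (wfI : well_formed I) (Tw : T tWord = encode I).

(** Each number starts where the previous one ends, and the unary code is prefix-free, so the parse
    is unique. Every end position is below [N] because the closing mark of the arc list follows. *)
Lemma sem_HeaderF e n s t p : all (fun x => x.1 < 8) [:: n; s; t; p] -> e p < N ->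
  sem N T e (HeaderF n s t p) <-> [/\ e n = nV I, e s = src I, e t = tgt I & e p = item_pos 0].
Proof.
case/and5P=> n8 s8 t8 p8 _ pN.
pose e3 i j k := upd (upd (upd e (8, 0) i) (8, 1) j) (8, 2) k.
have E3 x i j k : x.1 < 8 -> e3 i j k x = e x by move=> x8; rewrite /e3 !upd_class // neq_ltn /= x8.
have ne9 (x : ident) : x.1 < 8 -> x.1 != 9 by lia.
have r1 : drop 0 w = enc_nat (nV I) ++ enc_nat (src I) ++ enc_nat (tgt I) ++ enc_arcs (arcs I) by rewrite drop0.
have r2 := nat_at_next r1; have r3 := nat_at_next r2; have r4 := nat_at_next r3.
have Ne := size_encode; have p0 := item_pos0.
split.
  case/sem_ExP=> i iN /sem_ExP[j jN] /sem_ExP[k kN]; rewrite -/(e3 i j k).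
  rewrite sem_And sem_Zero => /andP[/eqP i0]; rewrite -[e3 _ _ _ _]/i in i0; subst i.
  rewrite sem_And => /andP[A1]; rewrite sem_And => /andP[A2 A3].
  have [] := (@sem_NatF _ _ Tw (e3 0 j k) (8, 0) n (8, 1) isT (ne9 _ n8) jN).1 A1.
  rewrite (E3 n) // => A Ej; have En := nat_at_eq r1 A; rewrite -[e3 _ _ _ _]/j -[e3 _ _ _ (8, 0)]/0 in Ej.
  have [] := (@sem_NatF _ _ Tw (e3 0 j k) (8, 1) s (8, 2) isT (ne9 _ s8) kN).1 A2.
  rewrite (E3 s) // -[e3 _ _ _ (8, 2)]/k -[e3 _ _ _ (8, 1)]/j Ej En => B Ek; have Es := nat_at_eq r2 B.
  have pN' : e3 0 j k p < N by rewrite E3.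
  have [] := (@sem_NatF _ _ Tw (e3 0 j k) (8, 2) t p isT (ne9 _ t8) pN').1 A3; rewrite (E3 p) // (E3 t) //.
  rewrite -[e3 _ _ _ (8, 2)]/k Ek Es => C Ep; have Et := nat_at_eq r3 C; split=> //; lia.
case=> En Es Et Ep.
apply/sem_ExP; exists 0; first by lia.
pose j := (0 + nV I).+1; pose k := (j + src I).+1.
have jN : j < N by rewrite /j; lia.
have kN : k < N by rewrite /k /j; lia.
have pN' : e3 0 j k p < N by rewrite E3.
apply/sem_ExP; exists j; first exact: jN.
apply/sem_ExP; exists k; first exact: kN.
rewrite -/(e3 0 j k) sem_And sem_Zero; apply/andP; split=> //.
rewrite sem_And; apply/andP; split.
  apply: (@sem_NatF _ _ Tw (e3 0 j k) (8, 0) n (8, 1) isT (ne9 _ n8) jN).2.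
  by rewrite (E3 n) // En; split=> //; eexists; exact: r1.
rewrite sem_And; apply/andP; split.
  apply: (@sem_NatF _ _ Tw (e3 0 j k) (8, 1) s (8, 2) isT (ne9 _ s8) kN).2.
  by rewrite (E3 s) // Es; split=> //; eexists; exact: r2.
apply: (@sem_NatF _ _ Tw (e3 0 j k) (8, 2) t p isT (ne9 _ t8) pN').2.
rewrite (E3 t) // (E3 p) // Et Ep; split; first by eexists; exact: r3.
rewrite -[e3 _ _ _ _]/k /k /j; lia.
Qed.

Lemma sem_CellF e c u v q i : all (fun x => x.1 < 8) [:: c; u; v; q] -> e q < N -> i <= size (arcs I) ->
  e c = item_pos i ->
  sem N T e (CellF c u v q) <->
  [/\ i < size (arcs I), e u = arc_tail I i, e v = arc_head I i & e q = item_pos i.+1].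
Proof.
case/and5P=> c8 u8 v8 q8 _ qN le Ec.
pose e3 i j := upd (upd e (8, 0) i) (8, 1) j.
have E3 x i' j : x.1 < 8 -> e3 i' j x = e x by move=> x8; rewrite /e3 !upd_class // neq_ltn /= x8.
have ne9 (x : ident) : x.1 < 8 -> x.1 != 9 by lia.
have Eb : sem N T e (Bit c) = (i < size (arcs I)).
  rewrite (sem_Bit Tw) Ec -[item_pos i]addn0 -nth_drop drop_item.
  case: ltnP => [lt|ge]; first by rewrite enc_arcs_drop.
  by rewrite drop_oversize.
rewrite /CellF sem_And Eb; split.
  case/andP=> lt; have r0 := drop_item i; rewrite (enc_arcs_drop lt) in r0.
  have r1 := congr1 behead r0; rewrite -[behead _]drop1 drop_drop [behead _]/= add1n in r1.
  have r2 := nat_at_next r1.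
  case/sem_ExP=> j jN /sem_ExP[k kN]; rewrite -/(e3 j k) sem_And sem_Sum => /andP[/eqP].
  rewrite /= (E3 c) // addn0 add1n Ec -[e3 _ _ _]/j => Ej; subst j.
  rewrite sem_And => /andP[A1 A2].
  have [] := (@sem_NatF _ _ Tw (e3 (item_pos i).+1 k) (8, 0) u (8, 1) isT (ne9 _ u8) kN).1 A1.
  rewrite (E3 u) // => A Ek; have Eu := nat_at_eq r1 A.
  rewrite -[e3 _ _ (8, 1)]/k -[e3 _ _ (8, 0)]/(item_pos i).+1 Eu in Ek.
  have qN' : e3 (item_pos i).+1 k q < N by rewrite E3.
  have [] := (@sem_NatF _ _ Tw (e3 (item_pos i).+1 k) (8, 1) v q isT (ne9 _ v8) qN').1 A2.
  rewrite (E3 v) // (E3 q) // -[e3 _ _ (8, 1)]/k Ek => B Eq; have Ev := nat_at_eq r2 B.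
  by split=> //; rewrite item_posS // Eq Ev; lia.
case=> lt Eu Ev Eq; rewrite lt /=.
have r0 := drop_item i; rewrite (enc_arcs_drop lt) in r0.
have r1 := congr1 behead r0; rewrite -[behead _]drop1 drop_drop [behead _]/= add1n in r1.
have r2 := nat_at_next r1.
pose j := (item_pos i).+1; pose k := (j + arc_tail I i).+1.
have Pi := item_posS lt; have Li := item_pos_lt i.+1.
have jN : j < N by rewrite /j; lia.
have kN : k < N by rewrite /k /j; lia.
have qN' : e3 j k q < N by rewrite E3.
apply/sem_ExP; exists j; first exact: jN.
apply/sem_ExP; exists k; first exact: kN.
rewrite -/(e3 j k) sem_And sem_Sum; apply/andP; split.
  by rewrite /= (E3 c) // addn0 add1n Ec.
rewrite sem_And; apply/andP; split.
  apply: (@sem_NatF _ _ Tw (e3 j k) (8, 0) u (8, 1) isT (ne9 _ u8) kN).2.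
  by rewrite (E3 u) // Eu; split=> //; eexists; exact: r1.
apply: (@sem_NatF _ _ Tw (e3 j k) (8, 1) v q isT (ne9 _ v8) qN').2.
rewrite (E3 v) // (E3 q) // Ev Eq; split; first by eexists; exact: r2.
rewrite -[e3 _ _ _]/k /k /j; lia.
Qed.

Lemma values_lt : [/\ nV I < N, src I < N, tgt I < N & forall i, i < size (arcs I) -> arc_tail I i < N /\ arc_head I i < N].
Proof.
have n := nV_lt; case/and3P: (wfI) => s t _; split=> //; try exact: ltn_trans n.
by move=> i /(arc_bounded wfI)[a b]; split; apply: ltn_trans n.
Qed.

Lemma sem_SrcF e x : x.1 < 7 -> sem N T e (SrcF x) = (e x == src I).
Proof.
move=> x7; have x8 : x.1 < 8 by apply: ltnW.
have [nN sN tN _] := values_lt.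
pose e3 i j k := upd (upd (upd e (7, 0) i) (7, 1) j) (7, 2) k.
have E3 i j k : e3 i j k x = e x by rewrite /e3 !upd_class // neq_ltn /= x7.
apply/idP/eqP => [/sem_ExP[i iN /sem_ExP[j jN /sem_ExP[k kN]]]|Ex].
  rewrite -/(e3 i j k) => H.
  have [] := (@sem_HeaderF (e3 i j k) (7, 0) x (7, 1) (7, 2) _ kN).1 H; first by rewrite /= x8.
  by rewrite E3.
apply/sem_ExP; exists (nV I) => //; apply/sem_ExP; exists (tgt I) => //.
have pN := item_pos_lt 0; apply/sem_ExP; exists (item_pos 0) => //.
rewrite -/(e3 (nV I) (tgt I) (item_pos 0)).
apply: (@sem_HeaderF (e3 (nV I) (tgt I) (item_pos 0)) (7, 0) x (7, 1) (7, 2) _ pN).2; first by rewrite /= x8.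
by split=> //; rewrite E3.
Qed.

Lemma sem_TgtF e x : x.1 < 7 -> sem N T e (TgtF x) = (e x == tgt I).
Proof.
move=> x7; have x8 : x.1 < 8 by apply: ltnW.
have [nN sN tN _] := values_lt.
pose e3 i j k := upd (upd (upd e (7, 0) i) (7, 1) j) (7, 2) k.
have E3 i j k : e3 i j k x = e x by rewrite /e3 !upd_class // neq_ltn /= x7.
apply/idP/eqP => [/sem_ExP[i iN /sem_ExP[j jN /sem_ExP[k kN]]]|Ex].
  rewrite -/(e3 i j k) => H.
  have [] := (@sem_HeaderF (e3 i j k) (7, 0) (7, 1) x (7, 2) _ kN).1 H; first by rewrite /= x8.
  by rewrite E3.
apply/sem_ExP; exists (nV I) => //; apply/sem_ExP; exists (src I) => //.
have pN := item_pos_lt 0; apply/sem_ExP; exists (item_pos 0) => //.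
rewrite -/(e3 (nV I) (src I) (item_pos 0)).
apply: (@sem_HeaderF (e3 (nV I) (src I) (item_pos 0)) (7, 0) (7, 1) x (7, 2) _ pN).2; first by rewrite /= x8.
by split=> //; rewrite E3.
Qed.

Definition item_stage m (ys : seq nat) :=
  exists i, [/\ i < m, i <= size (arcs I) & ys = [:: item_pos i]].

Lemma sem_ItemF m e :
  (forall ys, size ys = 1 -> all (fun y => y < N) ys -> rel_of N T tItem ys <-> item_stage m ys) ->
  e (4, 0) < N -> sem N T e (ItemF (4, 0)) <-> item_stage m.+1 [:: e (4, 0)].
Proof.
move=> IH eN; rewrite /ItemF sem_Or.
have [nN sN tN aN] := values_lt.
pose e3 i j k := upd (upd (upd e (6, 0) i) (6, 1) j) (6, 2) k.
split.
  case/orP=> /sem_ExP[i iN /sem_ExP[j jN /sem_ExP[k kN]]]; rewrite -/(e3 i j k).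
    move=> H; have [_ _ _ E] := (@sem_HeaderF (e3 i j k) (6, 0) (6, 1) (6, 2) (4, 0) isT eN).1 H.
    by exists 0; rewrite -E.
  rewrite sem_And sem_Rel => /andP[Hr H].
  have iN' : all (fun y => y < N) [:: i] by rewrite /= iN.
  have [i' [im ile [Ei]]] := (IH [:: i] erefl iN').1 Hr.
  have [_ _ _ E] := (@sem_CellF (e3 i j k) (6, 0) (6, 1) (6, 2) (4, 0) i' isT eN ile Ei).1 H.
  have [lt _ _ _] := (@sem_CellF (e3 i j k) (6, 0) (6, 1) (6, 2) (4, 0) i' isT eN ile Ei).1 H.
  by exists i'.+1; rewrite -E.
case=> -[|i] [im ile [Ei]]; apply/orP; [left|right].
  apply/sem_ExP; exists (nV I) => //; apply/sem_ExP; exists (src I) => //; apply/sem_ExP; exists (tgt I) => //.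
  exact: (@sem_HeaderF (e3 (nV I) (src I) (tgt I)) (6, 0) (6, 1) (6, 2) (4, 0) isT eN).2.
have pN := item_pos_lt i; have [tailN headN] := aN i ile.
apply/sem_ExP; exists (item_pos i) => //; apply/sem_ExP; exists (arc_tail I i) => //.
apply/sem_ExP; exists (arc_head I i) => //; rewrite sem_And; apply/andP; split.
  rewrite sem_Rel; apply: (IH [:: item_pos i] erefl _).2; first by rewrite /= pN.
  by exists i; split=> //; apply: ltnW.
exact: (@sem_CellF (e3 (item_pos i) (arc_tail I i) (arc_head I i)) (6, 0) (6, 1) (6, 2) (4, 0) i isT eN (ltnW ile) erefl).2.
Qed.

Definition items_ok := forall ys, size ys = 1 -> all (fun y => y < N) ys -> rel_of N T tItem ys <-> item_stage N ys.

Lemma sem_ArcF e c u v : items_ok -> all (fun x => x.1 < 7) [:: c; u; v] -> e c < N ->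
  sem N T e (ArcF c u v) <-> coded_arc I item_pos (e c) (e u) (e v).
Proof.
move=> Hi /and4P[c7 u7 v7 _] cN; rewrite /ArcF sem_And sem_Rel.
have al : all (fun x : ident => x.1 < 8) [:: c; u; v; (7, 0)] by rewrite /= !(leqW c7, leqW u7, leqW v7).
have cN' : all (fun y => y < N) [:: e c] by rewrite /= cN.
have E3 (x : ident) i : x.1 < 7 -> upd e (7, 0) i x = e x by move=> x7; rewrite upd_class // neq_ltn /= x7.
split.
  case/andP=> /(Hi [:: e c] erefl cN')[i [_ ile [Ec]]] /sem_ExP[j jN].
  rewrite -(E3 c j) // in Ec => /(@sem_CellF _ c u v (7, 0) i al jN ile Ec)[lt].
  rewrite -/(upd e (7, 0) j u) -/(upd e (7, 0) j v) !E3 // => Eu Ev _.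
  by exists i; rewrite -(E3 c j) // Ec.
case=> i [lt Ec Eu Ev]; apply/andP; split.
  apply: (Hi [:: e c] erefl cN').2; exists i; split; rewrite ?Ec //; last exact: ltnW.
  have := item_pos_lt 0; have := size_enc_arcs (arcs I); have := size_encode; lia.
apply/sem_ExP; exists (item_pos i.+1); first exact: item_pos_lt.
have Ec' : upd e (7, 0) (item_pos i.+1) c = item_pos i by rewrite E3.
apply: (@sem_CellF _ c u v (7, 0) i al (item_pos_lt _) (ltnW lt) Ec').2.
by rewrite (E3 u) // (E3 v).
Qed.

Definition reach_stage m (ys : seq nat) :=
  if ys is [:: u; v] then exists p, walk I u v p /\ size p < m else False.

Lemma sem_ReachF m e : items_ok ->
  (forall ys, size ys = 2 -> all (fun y => y < N) ys -> rel_of N T tReach ys <-> reach_stage m ys) ->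
  e (4, 0) < N -> e (4, 1) < N ->
  sem N T e (ReachF (4, 0) (4, 1)) <-> reach_stage m.+1 [:: e (4, 0); e (4, 1)].
Proof.
move=> Hi IH uN vN; rewrite /ReachF sem_Or sem_Eq; have [_ _ _ aN] := values_lt.
pose e2 i j := upd (upd e (6, 0) i) (6, 1) j.
split.
  case/predU1P=> [->|/sem_ExP[i iN /sem_ExP[j jN]]]; first by exists [::]; rewrite /= eqxx.
  rewrite -/(e2 i j) sem_And sem_Rel => /andP[Ha Hr].
  have [a [la _ ta ha]] := (@sem_ArcF (e2 i j) (6, 0) (4, 0) (6, 1) Hi isT iN).1 Ha.
  have jN' : all (fun y => y < N) [:: j; e (4, 1)] by rewrite /= jN vN.
  have [p [Wp sp]] := (IH [:: j; e (4, 1)] erefl jN').1 Hr.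
  by exists (a :: p); rewrite /= la ta ha eqxx.
case=> -[|a p] /= [W sp]; first by rewrite W.
apply/orP; right; case/and3P: W => la /eqP ta W; have [_ hN] := aN a la.
have iN := item_pos_lt a.
apply/sem_ExP; exists (item_pos a) => //; apply/sem_ExP; exists (arc_head I a) => //.
rewrite -/(e2 _ _) sem_And sem_Rel; apply/andP; split.
  by apply: (@sem_ArcF (e2 _ _) (6, 0) (4, 0) (6, 1) Hi isT iN).2; exists a.
apply: (IH [:: arc_head I a; e (4, 1)] erefl _).2; first by rewrite /= hN vN.
by exists p.
Qed.

End Instance.

(** * The formula for the pebble game *)

Section Win.
Variable k : nat.

(* Variable [(0, i)] is the vertex of pebble [i] before a move, [(1, i)] the one
   after it, [(2, i)] the arc it takes, [(6, 0)] the vertex at which pebbles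
   move, and [pair_var i j] the arc that paths [i < j] may share. *)
Definition pair_vars : seq ident := [seq (3, n) | n <- iota 0 (k * k)].
Definition pebble_vars c : seq ident := [seq (c, n) | n <- iota 0 k].
Definition pair_var i j : ident := (3, i * k + j).

Definition TrueF := Le 0 [::] (9, 0).

Definition MoveF :=
  And (Not (TgtF (6, 0)))
  (And (Any k (fun i => Eq (0, i) (6, 0)))
  (And (All k (fun i =>
     Or (And (Not (Eq (0, i) (6, 0)))
          (And (Or (TgtF (0, i)) (Not (Rel tReach [:: (0, i); (6, 0)]))) (Eq (1, i) (0, i))))
        (And (Eq (0, i) (6, 0)) (ArcF (2, i) (6, 0) (1, i)))))
  (All k (fun i => All k (fun j => if i < j then
     Or (Not (And (Eq (0, i) (6, 0)) (And (Eq (0, j) (6, 0)) (Eq (2, i) (2, j)))))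
        (And (Eq (pair_var i j) (2, i)) (Not (And (SrcF (6, 0)) (TgtF (1, i)))))
     else TrueF))))).

(** The guessed arcs are arguments of the relation and are passed on unchanged, as they must be the
    same in all rounds. *)
Definition WinF :=
  Or (All k (fun i => TgtF (0, i)))
     (ExAll (And MoveF (Rel tWin (pebble_vars 1 ++ pair_vars))) (pebble_vars 1 ++ pebble_vars 2 ++ [:: (6, 0)])).

Definition ADPF :=
  And (if k <= 1 then TrueF else Not (Ex (6, 0) (And (SrcF (6, 0)) (TgtF (6, 0)))))
      (ExAll (And (All k (fun i => SrcF (0, i))) (Rel tWin (pebble_vars 0 ++ pair_vars))) (pebble_vars 0 ++ pair_vars)).

(** One loop, thus [N] stages, suffices for the first two relations: there are at most [N] entries,
    and walks have at most [nV I < N] arcs. The game gets the [N ^ k.+1] stages of [ADP_win]. *)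
Definition ADPprog :=
  Then (iter 1 (For (9, 9)) (Tab tItem [:: (4, 0)] (ItemF (4, 0))))
  (Then (iter 1 (For (9, 9)) (Tab tReach [:: (4, 0); (4, 1)] (ReachF (4, 0) (4, 1))))
  (iter k.+1 (For (9, 9)) (Tab tWin (pebble_vars 0 ++ pair_vars) WinF))).

Lemma pair_index_lt i j : i < k -> j < k -> i * k + j < k * k.
Proof. by move=> ik jk; have := leq_mul ik (leqnn k); rewrite mulSn; lia. Qed.

Lemma mem_pebble_vars c x : (x \in pebble_vars c) = (x.1 == c) && (x.2 < k).
Proof.
apply/mapP/andP => [[n]|[/eqP <- ltk]]; first by rewrite mem_iota => nk ->.
by exists x.2; rewrite ?mem_iota //; case: x {ltk}.
Qed.

Lemma mem_pair_vars x : (x \in pair_vars) = (x.1 == 3) && (x.2 < k * k).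
Proof.
apply/mapP/andP => [[n]|[/eqP <- ltk]]; first by rewrite mem_iota => nk ->.
by exists x.2; rewrite ?mem_iota //; case: x {ltk}.
Qed.

Lemma uniq_args : uniq (pebble_vars 0 ++ pair_vars).
Proof.
rewrite cat_uniq !map_inj_uniq ?iota_uniq ?andbT; try by move=> a b [].
by apply/hasPn => x /=; rewrite mem_pair_vars mem_pebble_vars => /andP[/eqP-> _].
Qed.

Lemma nth_pebble_var (e : env) c i : i < k -> nth 0 (map e (pebble_vars c ++ pair_vars)) i = e (c, i).
Proof.
move=> ik; rewrite map_cat nth_cat !size_map size_iota ik.
by rewrite -map_comp (nth_map 0) ?size_iota // nth_iota.
Qed.

Lemma nth_pair_var (e : env) c i j : i < k -> j < k ->
  nth 0 (map e (pebble_vars c ++ pair_vars)) (k + (i * k + j)) = e (pair_var i j).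
Proof.
move=> ik jk; have lt := pair_index_lt ik jk.
rewrite map_cat nth_cat !size_map size_iota ltnNge leq_addr /= addKn.
by rewrite -map_comp (nth_map 0) ?size_iota // nth_iota.
Qed.

Variables (I : instance).
Hypotheses (wfI : well_formed I) (acI : acyclic I).
Let N := size (encode I).

Definition win_stage m (ys : seq nat) :=
  win k I N (item_pos I) m (fun i j => nth 0 ys (k + (i * k + j))) (fun i => nth 0 ys i).

Lemma win_stageE m (e : env) c : win_stage m (map e (pebble_vars c ++ pair_vars)) <->
  win k I N (item_pos I) m (fun i j => e (pair_var i j)) (fun i => e (c, i)).
Proof.
by rewrite /win_stage; split; apply: win_ext => [i ik|i j ik jk];
  [rewrite nth_pebble_var | rewrite nth_pair_var | rewrite nth_pebble_var | rewrite nth_pair_var].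
Qed.

Variable T : tables.
Hypotheses (Tw : T tWord = encode I) (Titem : items_ok I T)
  (Treach : forall u v, u < N -> v < N -> rel_of N T tReach [:: u; v] <-> reach I u v).

Lemma sem_MoveF e : (forall c i, c < 3 -> i < k -> e (c, i) < N) -> e (6, 0) < N ->
  sem N T e MoveF <->
  [/\ e (6, 0) <> tgt I, exists2 i, i < k & e (0, i) = e (6, 0),
    forall i, i < k -> [/\ e (0, i) <> e (6, 0), e (0, i) = tgt I \/ ~ reach I (e (0, i)) (e (6, 0)) & e (1, i) = e (0, i)] \/
                       e (0, i) = e (6, 0) /\ coded_arc I (item_pos I) (e (2, i)) (e (6, 0)) (e (1, i)) &
    forall i j, i < j < k -> e (0, i) = e (6, 0) -> e (0, j) = e (6, 0) -> e (2, i) = e (2, j) ->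
      e (pair_var i j) = e (2, i) /\ ~ (e (6, 0) = src I /\ e (1, i) = tgt I)].
Proof.
move=> eN uN; rewrite /MoveF sem_And sem_Not (sem_TgtF wfI Tw) // sem_And sem_And.
set B1 := sem _ _ _ (Any _ _); set B2 := sem _ _ _ (All _ _); set B3 := sem _ _ _ (All _ _).
have E1 : reflect (exists2 i, i < k & e (0, i) = e (6, 0)) B1.
  apply: (iffP (sem_AnyP _ _ _ _ _)) => -[i ik H]; exists i => //; move: H; rewrite sem_Eq; first by move/eqP.
  by move->.
have E2 : B2 <-> forall i, i < k -> [/\ e (0, i) <> e (6, 0), e (0, i) = tgt I \/ ~ reach I (e (0, i)) (e (6, 0)) & e (1, i) = e (0, i)] \/
                       e (0, i) = e (6, 0) /\ coded_arc I (item_pos I) (e (2, i)) (e (6, 0)) (e (1, i)).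
  suff H i : i < k -> sem N T e (Or (And (Not (Eq (0, i) (6, 0)))
       (And (Or (TgtF (0, i)) (Not (Rel tReach [:: (0, i); (6, 0)]))) (Eq (1, i) (0, i))))
       (And (Eq (0, i) (6, 0)) (ArcF (2, i) (6, 0) (1, i)))) <->
     [/\ e (0, i) <> e (6, 0), e (0, i) = tgt I \/ ~ reach I (e (0, i)) (e (6, 0)) & e (1, i) = e (0, i)] \/
     e (0, i) = e (6, 0) /\ coded_arc I (item_pos I) (e (2, i)) (e (6, 0)) (e (1, i)).
    by rewrite -(rwP (sem_AllP _ _ _ _ _)); split=> K i ik; apply/H => //; apply: K.
  move=> ik; have Hr := Treach (eN 0 i isT ik) uN.
  have Ha := @sem_ArcF I T wfI Tw e (2, i) (6, 0) (1, i) Titem isT (eN 2 i isT ik).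
  rewrite sem_Or sem_And sem_Not sem_Eq sem_And sem_Or (sem_TgtF wfI Tw) // sem_Not sem_Rel sem_Eq sem_And sem_Eq.
  split.
    case/orP=> [/and3P[/eqP xu /orP xt /eqP yx]|/andP[/eqP xu /Ha]]; [left|by right].
    split=> //; case: xt => [/eqP|nr]; [by left|right].
    by move/Hr; apply/negP.
  case=> [[/eqP xu xt /eqP yx]|[/eqP xu /Ha ->]]; apply/orP; [left|by right; rewrite xu].
  rewrite xu yx andbT /=; apply/orP; case: xt => [/eqP|nr]; [by left|right].
  by apply/negP => /Hr.
have E3 : B3 <-> forall i j, i < j < k -> e (0, i) = e (6, 0) -> e (0, j) = e (6, 0) -> e (2, i) = e (2, j) ->
      e (pair_var i j) = e (2, i) /\ ~ (e (6, 0) = src I /\ e (1, i) = tgt I).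
  have H i j : i < j -> sem N T e (if i < j then
       Or (Not (And (Eq (0, i) (6, 0)) (And (Eq (0, j) (6, 0)) (Eq (2, i) (2, j)))))
          (And (Eq (pair_var i j) (2, i)) (Not (And (SrcF (6, 0)) (TgtF (1, i)))))
     else TrueF) <-> (e (0, i) = e (6, 0) -> e (0, j) = e (6, 0) -> e (2, i) = e (2, j) ->
      e (pair_var i j) = e (2, i) /\ ~ (e (6, 0) = src I /\ e (1, i) = tgt I)).
    move=> ->; rewrite sem_Or sem_Not sem_And sem_Eq sem_And !sem_Eq sem_And sem_Eq sem_Not sem_And.
    rewrite (sem_SrcF wfI Tw) // (sem_TgtF wfI Tw) //; split.
      move=> /orP[+ xi xj aij|/andP[/eqP-> /negP st] _ _ _]; first by rewrite xi xj aij !eqxx.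
      by split=> // -[us yt]; apply: st; rewrite us yt !eqxx.
    move=> K; rewrite -implybE; apply/implyP => /and3P[/eqP xi /eqP xj /eqP aij].
    have [-> st] := K xi xj aij; rewrite eqxx /=; apply/negP => /andP[/eqP us /eqP yt]; exact: st.
  split=> K.
    move=> i j /andP[ij jk]; apply/(H i j ij).
    by move/sem_AllP: K => /(_ i (ltn_trans ij jk))/sem_AllP/(_ j jk).
  apply/sem_AllP => i ik; apply/sem_AllP => j jk; case: (ltnP i j) => [ij|//].
  by have := (H i j ij).2; rewrite ij; apply; apply: K; rewrite ij.
split.
  by case/and4P=> /eqP ut /E1 ex /E2 A /E3 B.
by case=> /eqP ut /E1 ex /E2 A /E3 B; apply/and4P.
Qed.

Lemma sem_WinF m e :
  (forall ys, size ys = size (pebble_vars 0 ++ pair_vars) -> all (fun y => y < N) ys -> rel_of N T tWin ys <-> win_stage m ys) ->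
  all (fun x => e x < N) (pebble_vars 0 ++ pair_vars) ->
  sem N T e WinF <-> win_stage m.+1 (map e (pebble_vars 0 ++ pair_vars)).
Proof.
move=> IH; rewrite all_cat => /andP[/allP xN /allP eN].
have xN' i : i < k -> e (0, i) < N by move=> ik; apply: xN; rewrite mem_pebble_vars.
have eN' n : n < k * k -> e (3, n) < N by move=> nk; apply: eN; rewrite mem_pair_vars.
have inL x : (x \in pebble_vars 1 ++ pebble_vars 2 ++ [:: (6, 0)]) =
    [|| (x.1 == 1) && (x.2 < k), (x.1 == 2) && (x.2 < k) | x == (6, 0)].
  by rewrite !mem_cat !mem_pebble_vars inE.
have IH' (e' : env) : (forall i, i < k -> e' (1, i) < N) -> (forall n, n < k * k -> e' (3, n) < N) ->
   sem N T e' (Rel tWin (pebble_vars 1 ++ pair_vars)) <->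
   win k I N (item_pos I) m (fun i j => e' (pair_var i j)) (fun i => e' (1, i)).
  move=> yN e'N; rewrite sem_Rel -win_stageE; apply: IH; first by rewrite size_map !size_cat !size_map !size_iota.
  rewrite all_map; apply/allP => x /=; rewrite mem_cat mem_pebble_vars mem_pair_vars.
  by case: x => c n /= /orP[] /andP[/eqP-> nk]; [apply: yN | apply: e'N].
rewrite win_stageE /WinF sem_Or /=; split.
  case/orP=> [/sem_AllP H|/sem_ExAllP[e' [out inn]]].
    by left=> i ik; have := H i ik; rewrite (sem_TgtF wfI Tw) // => /eqP.
  have e'N c i : c < 3 -> i < k -> e' (c, i) < N.
    case: c => [|[|[|//]]] _ ik.
    - by rewrite out ?inL //; apply: xN'.
    - by apply: inn; rewrite inL ik.
    - by apply: inn; rewrite inL ik.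
  have uN : e' (6, 0) < N by apply: inn; rewrite inL eqxx !orbT.
  have Ex i : e' (0, i) = e (0, i) by rewrite out // inL.
  have Ee n : e' (3, n) = e (3, n) by rewrite out // inL.
  rewrite sem_And => /andP[/(sem_MoveF e'N uN)[H1 H2 H3 H4] /IH' H5].
  right; exists (fun i => e' (1, i)); first by move=> i; apply: e'N.
  split; last first.
    have := H5 (fun i => e'N 1 i isT) (fun n nk => eq_ind_r (fun x => x < N) (eN' n nk) (Ee n)).
    by apply: win_ext => // i j _ _; rewrite /pair_var Ee.
  exists (e' (6, 0)), (fun i => e' (2, i)); split=> //.
  - by split=> // i; apply: e'N.
  - by case: H2 => i ik; rewrite Ex; exists i.
  - by move=> i ik; have := H3 i ik; rewrite Ex.
  - by move=> i j ijk xi xj; rewrite -Ee; apply: H4; rewrite ?Ex.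
case=> [H|[y yN [[u [a [[uN aN] ut ex Hm He]]] Hw]]]; apply/orP; [left|right].
  by apply/sem_AllP => i ik; rewrite (sem_TgtF wfI Tw) // H.
pose e' (x : ident) := if x == (6, 0) then u else if (x.1 == 1) && (x.2 < k) then y x.2
  else if (x.1 == 2) && (x.2 < k) then a x.2 else e x.
have e'1 i : i < k -> e' (1, i) = y i by rewrite /e' xpair_eqE /= => ->.
have e'2 i : i < k -> e' (2, i) = a i by rewrite /e' xpair_eqE /= => ->.
have e'N c i : c < 3 -> i < k -> e' (c, i) < N.
  case: c => [|[|[|//]]] _ ik; [exact: xN' | by rewrite e'1 // yN | by rewrite e'2 // aN].
apply/sem_ExAllP; exists e'; split.
- by move=> x; rewrite inL /e' !negb_or => /and3P[/negbTE-> /negbTE-> /negbTE->].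
- move=> x; rewrite inL => /or3P[/andP[]|/andP[]|/eqP->] //; case: x => c n /= /eqP-> nk.
    exact: e'N.
  exact: e'N.
rewrite sem_And; apply/andP; split.
  apply/(sem_MoveF e'N) => //; split=> //.
  - by move=> i ik; rewrite e'1 // e'2 //; apply: Hm.
  - by move=> i j ijk; have /andP[ij jk] := ijk; rewrite e'1 ?(ltn_trans ij jk) // !e'2 ?(ltn_trans ij jk) //; apply: He.
apply/IH'; [by move=> i; apply: e'N | exact: eN' |].
by apply: win_ext Hw => // i ik; rewrite e'1.
Qed.

Lemma sem_ADPF :
  (forall ys, size ys = size (pebble_vars 0 ++ pair_vars) -> all (fun y => y < N) ys ->
     rel_of N T tWin ys <-> win_stage (N ^ k.+1) ys) ->
  sem N T env0 ADPF <-> ADP k I.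
Proof.
move=> Hwin; have [nVN sN tN aN] := values_lt wfI.
rewrite (ADP_win k wfI acI nVN (@item_pos_inj I) (fun a _ => item_pos_lt I a)).
rewrite /ADPF sem_And (_ : sem _ _ _ (if _ then _ else _) = (k <= 1) || (src I != tgt I)); last first.
  case: ifP => // _; rewrite sem_Not; congr negb; apply/sem_ExP/eqP => [[i iN]|st].
    by rewrite sem_And (sem_SrcF wfI Tw) // (sem_TgtF wfI Tw) // => /andP[/eqP <- /eqP].
  by exists (src I); rewrite // sem_And (sem_SrcF wfI Tw) // (sem_TgtF wfI Tw) // -st; apply/andP.
have IH (e : env) : (forall x, x \in pebble_vars 0 ++ pair_vars -> e x < N) ->
   sem N T e (Rel tWin (pebble_vars 0 ++ pair_vars)) <->
   win k I N (item_pos I) (N ^ k.+1) (fun i j => e (pair_var i j)) (fun i => e (0, i)).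
  move=> eN; rewrite sem_Rel -win_stageE; apply: Hwin; first by rewrite size_map.
  by rewrite all_map; apply/allP => x /eN.
split=> [/andP[st /sem_ExAllP[e [_ eN]]]|[st [e eN Hw]]].
  rewrite sem_And => /andP[/sem_AllP Hs /(IH _ eN) Hw].
  split; first by case/orP: st => [|/eqP]; [left|right].
  exists (fun i j => if (i < k) && (j < k) then e (pair_var i j) else 0).
    move=> i j; case: ifP => [/andP[ik jk]|_]; last by apply: leq_ltn_trans sN.
    by apply: eN; rewrite mem_cat mem_pair_vars /= pair_index_lt ?orbT.
  apply: win_ext Hw => [i ik|i j -> ->] //.
  by have := Hs i ik; rewrite (sem_SrcF wfI Tw) // => /eqP.
apply/andP; split; first by apply/orP; case: st => [|/eqP]; [left|right].
(* Quotient and remainder by [k] recover the pair [i], [j] from the index [i * k + j] of its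
   variable. *)
pose e' (x : ident) := if x \in pebble_vars 0 then src I else if x \in pair_vars then e (x.2 %/ k) (x.2 %% k) else 0.
have e'N x : x \in pebble_vars 0 ++ pair_vars -> e' x < N.
  by move=> _; rewrite /e'; case: ifP => // _; case: ifP => // _; apply: leq_ltn_trans sN.
have e'0 i : i < k -> e' (0, i) = src I by move=> ik; rewrite /e' mem_pebble_vars /= ik.
apply/sem_ExAllP; exists e'; split=> //.
  by move=> x; rewrite mem_cat negb_or /e' => /andP[/negbTE-> /negbTE->].
rewrite sem_And; apply/andP; split.
  by apply/sem_AllP => i ik; rewrite (sem_SrcF wfI Tw) // e'0.
apply/IH => //; apply: win_ext Hw => [i ik|i j ik jk]; first by rewrite e'0.
rewrite /e' mem_pebble_vars mem_pair_vars /= pair_index_lt // divnMDl ?modnMDl ?(leq_ltn_trans _ jk) //.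
by rewrite divn_small // addn0 modn_small.
Qed.
End Win.

(* For every fixed k there is a polynomial-time (Turing machine) algorithm that,
   on the encoding of a DAG G with vertices s, t, decides ADP with parameter k. *)
Theorem theorem4 (k : nat) :
  exists (Q : finType) (M : TM Q) (c d : nat),
    forall I : instance,
      well_formed I -> acyclic I ->
      exists b : bool,
        halts_with M (encode I) (c * (size (encode I)).+1 ^ d) b /\
        (b = true <-> ADP k I).
Proof.
have [Q [M [c [d H]]]] := program_machine (ADPprog k) (ADPF k).
exists Q, M, c, d => I wfI acI; eexists; split; first exact: H.
set N := size (encode I); set T0 := upd none _ _.
have T0w : T0 tWord = encode I by rewrite /T0 upd_same.
have T0n j : j != tWord -> T0 j = [::] by move=> jw; rewrite /T0 upd_other.
have nVN : nV I < N := nV_lt I.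
rewrite -[psem _ _ _ _]/(psem N env0 (iter k.+1 (For (9, 9)) (Tab tWin (pebble_vars k 0 ++ pair_vars k) (WinF k)))
  (psem N env0 (iter 1 (For (9, 9)) (Tab tReach [:: (4, 0); (4, 1)] (ReachF (4, 0) (4, 1))))
  (psem N env0 (iter 1 (For (9, 9)) (Tab tItem [:: (4, 0)] (ItemF (4, 0)))) T0))).
have [||m T e ag IH|T1o T1i] := @psem_stages tItem [:: (4, 0)] (ItemF (4, 0)) N T0 (item_stage I) isT _ _ _ 1 env0.
- exact: T0n.
- by move=> ys [i [//]].
- by case/andP=> eN _; apply: sem_ItemF => //; rewrite ag.
set T1 := psem _ _ _ T0 in T1o T1i *.
have T1w : T1 tWord = encode I by rewrite T1o.
(* Stated for every [T] that agrees with [T1] on [tItem], because the intermediate tables of both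
   later iterations have to satisfy it too. *)
have items T : T tWord = encode I -> T tItem = T1 tItem -> items_ok I T.
  by move=> _ E ys sy ay; rewrite /rel_of E; have := T1i ys sy ay; rewrite expn1.
have [||m T e ag IH|T2o T2r] := @psem_stages tReach [:: (4, 0); (4, 1)] (ReachF (4, 0) (4, 1)) N T1 (reach_stage I) isT _ _ _ 1 env0.
- by rewrite T1o // T0n.
- by case=> [|u [|v [|x ys]]] //= [p []].
- case/and3P=> e0 e1 _; apply: sem_ReachF => //; first by rewrite ag.
  by apply: items; rewrite ag.
set T2 := psem _ _ _ T1 in T2o T2r *.
have T2w : T2 tWord = encode I by rewrite T2o.
have reachP T : T tReach = T2 tReach ->
    forall u v, u < N -> v < N -> rel_of N T tReach [:: u; v] <-> reach I u v.
  move=> E u v uN vN; rewrite /rel_of E; have := T2r [:: u; v] erefl.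
  rewrite /= uN vN expn1 => /(_ isT) R; rewrite /rel_of in R; rewrite R.
  split=> [[p [W _]]|[p W]]; first by exists p.
  by exists p; split=> //; apply: leq_ltn_trans (walk_size wfI acI W) nVN.
have [||m T e ag IH|T3o T3r] := @psem_stages tWin (pebble_vars k 0 ++ pair_vars k) (WinF k) N T2 (win_stage k I) (uniq_args k) _ _ _ k.+1 env0.
- by rewrite T2o // T1o // T0n.
- by move=> ys.
- move=> eN; apply: sem_WinF => //; rewrite ?ag //.
  + by apply: items; rewrite ag // T2o.
  + by apply: reachP; rewrite ag.
set T3 := psem _ _ _ T2 in T3o T3r *.
apply: sem_ADPF => //.
- by rewrite T3o.
Qed.
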